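(* Let $k\ge 2$ be a fixed integer (independent of $n$) and let $\varepsilon\in(0,1)$. (i) For every fixed sequence $\boldsymbol\alpha=(\alpha_i)_{i=1,\dots,k}$ of non-negative real numbers and every fixed sequence $\boldsymbol\beta=(\beta_i)_{i=2,\dots,k}$ of vectors $\beta_i=(\beta_i^{(1)},\dots,\beta_i^{(d)})\in(-\infty,0]^d$, $$\mathbb{E}\big[N(\mathcal K_k,M_\varepsilon^{(\boldsymbol\alpha,\boldsymbol\beta)})\big]=\Omega\big(n^{f(\boldsymbol\alpha,\boldsymbol\beta)}\big)\qquad (n\to\infty),$$ where $$f(\boldsymbol\alpha,\boldsymbol\beta)=k+(1-\tau)\sum_{i=1}^k\alpha_i+\sum_{i=2}^k\sum_{h=1}^d\beta_i^{(h)}+\sum_{1\le i<j\le k}\gamma\,\min\Big\{\alpha_i+\alpha_j-1-d\max_{1\le h\le d}\max\{\beta_i^{(h)},\beta_j^{(h)}\},\,0\Big\}.$$ (ii) Let $k\ne\frac{2}{3-\tau}$ and let $(\boldsymbol\alpha^*,\boldsymbol\beta^* )=\arg\max f(\boldsymbol\alpha,\boldsymbol\beta)$, where the maximum is over all $\boldsymbol\alpha\in[0,\infty)^k$ and $\boldsymbol\beta\in((-\infty,0]^d)^{k-1}$. Then $\boldsymbol\alpha^*=(\alpha^*,\dots,\alpha^* )$ and $\boldsymbol\beta^*=(\beta^*,\dots,\beta^* )$, where $$\alpha^*=\begin{cases}\tfrac12&\text{if }k>\frac{2}{3-\tau}\\ 0&\text{if }k<\frac{2}{3-\tau}\end{cases}\qquad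 \beta^*=\begin{cases}[0,\dots,0]&\text{if }k>\frac{2}{3-\tau}\\ [-\tfrac1d,\dots,-\tfrac1d]&\text{if }k<\frac{2}{3-\tau}\end{cases}$$ and there exists a constant $c(\boldsymbol\alpha^*,\boldsymbol\beta^* )>0$, independent of $\varepsilon$ and of $n$, such that $$\lim_{n\to\infty}\mathbb{P}\left(\frac{N(\mathcal K_k,M_\varepsilon^{(\boldsymbol\alpha^*,\boldsymbol\beta^* )})}{n^{f(\boldsymbol\alpha^*,\boldsymbol\beta^* )}}\le c(\boldsymbol\alpha^*,\boldsymbol\beta^* )\right)=0.$$
   Context: Geometric inhomogeneous random graph (GIRG). Fix $\tau\in(2,3)$, $w_0>0$, $\gamma>1$ and an integer $d\ge1$. For $n\in\mathbb N$ the vertex set is $V=\{1,\dots,n\}$. Each vertex $i$ has a weight $\mathrm w_i$ and a position $\mathrm x_i$, all independent. The weights are i.i.d. Pareto: $\mathbb P(\mathrm w>w)=(w_0/w)^{\tau-1}$ for $w\ge w_0$, with mean $\mu=\mathbb E[\mathrm w]=\frac{\tau-1}{\tau-2}w_0$. The positions are i.i.d. uniform on the torus $\mathbb T^d=\mathbb R^d/\mathbb Z^d$ (identified with $[0,1)^d$). Conditionally on weights and positions, each pair of distinct vertices $u,v$ is joined by an edge independently with probability $$p_{uv}=\min\Big\{\Big(\frac{\mathrm w_u\mathrm w_v}{n\mu\|\mathrm x_u-\mathrm x_v\|^d}\Big)^\gamma,1\Big\},$$ where $\|x-y\|=\max_{1\le h\le d}|x^{(h)}-y^{(h)}|_C$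 and $|a-b|_C=\min\{|a-b|,1-|a-b|\}$. A $k$-clique $\mathcal K_k$ is a set of $k$ vertices that are pairwise connected. For $\eta\in\mathbb R$ and $\varepsilon\in(0,1)$ put $I_\varepsilon(n^\eta)=[\varepsilon(\mu n)^\eta,(\mu n)^\eta/\varepsilon]$. For $\boldsymbol\alpha=(\alpha_i)_{1\le i\le k}$ and $\boldsymbol\beta=(\beta_i)_{2\le i\le k}$, let $M_\varepsilon^{(\boldsymbol\alpha,\boldsymbol\beta)}$ be the set of lists $(v_1,\dots,v_k)$ of distinct vertices such that $\mathrm w_{v_i}\in I_\varepsilon(n^{\alpha_i})$ for all $1\le i\le k$, and $|\mathrm x_{v_i}^{(h)}-\mathrm x_{v_1}^{(h)}|_C\in I_\varepsilon(n^{\beta_i^{(h)}})$ for all $2\le i\le k$, $1\le h\le d$. By convention $\beta_1=[-\infty,\dots,-\infty]$, so in $f$ one has $\max\{\beta_1^{(h)},\beta_j^{(h)}\}=\beta_j^{(h)}$ for $j\ge2$. $N(\mathcal K_k,M_\varepsilon^{(\boldsymbol\alpha,\boldsymbol\beta)})$ denotes the number of $k$-element subsets of $V$ that form a $k$-clique and whose vertices can be listed in some order as an element of $M_\varepsilon^{(\boldsymbol\alpha,\boldsymbol\beta)}$. $g(n)=\Omega(a(n))$ means $\liminf_{n\to\infty}g(n)/a(n)>0$.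
   Formalization: Assumes ε·w0<1 if some α_i=0 and ε<1/2 if some β_i^(h)=0 (otherwise N=0 a.s. and the claim fails); in (ii), c is independent of n and of ε only over ε in (0,ε0], for each ε0<1 meeting this condition, since no c works for all ε. *)

(* Defs.v *)
From HB Require Import structures.
From mathcomp Require Import all_boot all_order all_algebra.
From mathcomp Require Import all_classical all_reals all_analysis.
Set Implicit Arguments.
Unset Strict Implicit.
Unset Printing Implicit Defensive.
Import Order.TTheory GRing.Theory Num.Theory.
Import numFieldNormedType.Exports.
Local Open Scope classical_set_scope.
Local Open Scope ring_scope.

(* g = Omega(a): the inferior limit of g / a is positive (possibly +oo). *)
Definition is_Omega (R : realType) (g : nat -> \bar R) (a : nat -> R) : Prop :=
  (0 < limn_einf (fun n => g n * ((a n)^-1)%:E))%E.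

(* Since every A i may be setT, the product rule over the whole finite family
   implies the one over each of its subfamilies. *)
Definition mutually_independent (R : realType) (disp : measure_display)
    (T : measurableType disp) (P : probability T R) (I : finType)
    (Y : I -> {RV P >-> R}) : Prop :=
  forall A : I -> set R, (forall i, measurable (A i)) ->
    P (\bigcap_i (Y i @^-1` A i)) = (\prod_i P (Y i @^-1` A i))%E.

(* The sigma-algebra generated by a family of random variables. *)
Definition sigma_of (R : realType) (disp : measure_display)
    (T : measurableType disp) (P : probability T R) (I : finType)
    (Y : I -> {RV P >-> R}) : set (set T) :=
  <<s [set C | exists i, exists2 A, measurable A & C = Y i @^-1` A] >>.

Section torus.
Variables (R : realType) (d : nat).

Definition circle_dist (a b : R) : R := Num.min `|a - b| (1 - `|a - b|).

Definition torus_dist (x y : 'I_d -> R) : R :=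
  \big[Num.max/0]_(h < d) circle_dist (x h) (y h).

End torus.

Definition mean_weight (R : realType) (tau w0 : R) : R :=
  (tau - 1) / (tau - 2) * w0.

(* The first branch is the value 1 that the minimum takes when the distance
   tends to 0; division by 0 would give 0 instead. *)
Definition conn_prob (R : realType) (tau w0 gamma : R) (d n : nat)
    (wu wv : R) (xu xv : 'I_d -> R) : R :=
  if torus_dist xu xv == 0 then 1
  else Num.min
    ((wu * wv / (n%:R * mean_weight tau w0 * torus_dist xu xv ^+ d)) `^ gamma) 1.

(* A GIRG on n vertices, realized on an arbitrary probability space. The uniform
   law on the torus is that of d independent coordinates uniform on [0, 1]; the
   end point 1 is a null set. *)
Record girg (R : realType) (tau w0 gamma : R) (d n : nat)
    (disp : measure_display) (T : measurableType disp)
    (P : probability T R) := Girg {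
  weight : 'I_n -> {RV P >-> R};
  position : 'I_n -> 'I_d -> {RV P >-> R};
  adj : T -> rel 'I_n;
  attribute := fun s : 'I_n + 'I_n * 'I_d =>
    match s with inl i => weight i | inr (i, h) => position i h end;
  edge_prob := fun (u v : 'I_n) (t : T) =>
    conn_prob tau w0 gamma n (weight u t) (weight v t)
      (fun h => position u h t) (fun h => position v h t);
  attribute_independent : mutually_independent attribute;
  weight_pareto : forall i w, w0 <= w ->
    ccdf (weight i) w = ((w0 / w) `^ (tau - 1))%:E;
  position_uniform : forall i h A, measurable A ->
    distribution P (position i h) A = uniform_prob (@ltr01 R) A;
  adj_sym : forall t, symmetric (adj t);
  adj_irrefl : forall t, irreflexive (adj t);
  adj_measurable : forall u v, measurable [set t | adj t u v];
  (* The conditional probability, given weights and positions, that the graph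
     is e is the product over pairs u < v of edge_prob or 1 - edge_prob. *)
  adj_conditional_law : forall (e : rel 'I_n) (B : set T),
    sigma_of attribute B ->
    P (B `&` [set t | forall u v : 'I_n, (u < v)%N -> adj t u v = e u v]) =
    (\int[P]_(t in B)
      (\prod_(u < n) \prod_(v < n | (u < v)%N)
         (if e u v then edge_prob u v t else 1 - edge_prob u v t))%:E)%E
}.

(* I_eps(n^eta) *)
Definition window (R : realType) (tau w0 eps eta : R) (n : nat) : interval R :=
  `[eps * (mean_weight tau w0 * n%:R) `^ eta,
    (mean_weight tau w0 * n%:R) `^ eta / eps].

Section cliques.
Variables (R : realType) (tau w0 gamma : R) (d n : nat).
Variables (disp : measure_display) (T : measurableType disp).
Variables (P : probability T R) (G : girg tau w0 gamma d n P).

(* Lists have k = m + 1 entries: the first one has index ord0, and 'I_m indexes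
   the others through lift ord0. *)
Variable m : nat.

Definition is_clique (t : T) (K : {set 'I_n}) : bool :=
  [forall u in K, forall v in K, (u != v) ==> adj G t u v].

Definition in_M (eps : R) (alpha : 'I_m.+1 -> R) (beta : 'I_m -> 'I_d -> R)
    (t : T) (v : {ffun 'I_m.+1 -> 'I_n}) : bool :=
  [&& injectiveb v,
      [forall i, weight G (v i) t \in window tau w0 eps (alpha i) n] &
      [forall i, forall h,
         circle_dist (position G (v (lift ord0 i)) h t)
                     (position G (v ord0) h t)
           \in window tau w0 eps (beta i h) n]].

Definition clique_count (eps : R) (alpha : 'I_m.+1 -> R)
    (beta : 'I_m -> 'I_d -> R) (t : T) : nat :=
  #|[set K : {set 'I_n} |
      [&& #|K| == m.+1, is_clique t K &
          [exists v : {ffun 'I_m.+1 -> 'I_n},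
             in_M eps alpha beta t v && (K == [set v i | i : 'I_m.+1])]]]|.

End cliques.

Section exponent.
Variables (R : realType) (tau gamma : R) (d m : nat).

Definition ext_beta (beta : 'I_m -> 'I_d -> R) (i : 'I_m.+1) (h : 'I_d)
    : \bar R :=
  if unlift ord0 i is Some i' then (beta i' h)%:E else -oo%E.

(* For i < j and 0 < d the extended maximum below is finite. *)
Definition exponent (alpha : 'I_m.+1 -> R) (beta : 'I_m -> 'I_d -> R) : R :=
  m.+1%:R + (1 - tau) * (\sum_i alpha i) + \sum_i \sum_h beta i h
  + \sum_(i < m.+1) \sum_(j < m.+1 | (i < j)%N)
      gamma * Num.min
        (alpha i + alpha j - 1
         - d%:R * fine (\big[maxe/-oo%E]_(h < d)
                          maxe (ext_beta beta i h) (ext_beta beta j h))) 0.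

Definition in_domain (alpha : 'I_m.+1 -> R) (beta : 'I_m -> 'I_d -> R) : Prop :=
  (forall i, 0 <= alpha i) /\ (forall i h, beta i h <= 0).

Definition is_argmax (alpha : 'I_m.+1 -> R) (beta : 'I_m -> 'I_d -> R) : Prop :=
  in_domain alpha beta /\
  forall alpha' beta', in_domain alpha' beta' ->
    exponent alpha' beta' <= exponent alpha beta.

Definition alpha_star (_ : 'I_m.+1) : R :=
  if 2 / (3 - tau) < m.+1%:R then 1 / 2 else 0.

Definition beta_star (_ : 'I_m) (_ : 'I_d) : R :=
  if 2 / (3 - tau) < m.+1%:R then 0 else - (1 / d%:R).

(* A window of exponent 0 is [eps, 1/eps] for every n, whereas weights are at
   least w0 and circle distances at most 1/2. If eps * w0 >= 1 (with some
   alpha i = 0) or eps >= 1/2 (with some beta i h = 0), then almost surely no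
   list satisfies the constraints, for any n, and the clique count is 0. *)
Definition windows_reachable (w0 eps : R) (alpha : 'I_m.+1 -> R)
    (beta : 'I_m -> 'I_d -> R) : Prop :=
  (forall i, alpha i = 0 -> eps * w0 < 1) /\
  (forall i h, beta i h = 0 -> eps < 1 / 2).

End exponent.

(* Main.v *)
Require Import Defs.
From HB Require Import structures.
From mathcomp Require Import all_boot all_order all_algebra.
From mathcomp Require Import all_classical all_reals all_analysis.
From mathcomp Require Import measurable_realfun.
From mathcomp Require Import ring lra.
Set Implicit Arguments.
Unset Strict Implicit.
Unset Printing Implicit Defensive.
Import Order.TTheory GRing.Theory Num.Theory.
Import numFieldNormedType.Exports.
Local Open Scope classical_set_scope.
Local Open Scope ring_scope.

(** Write [k = m.+1] for the size of the cliques and [a] for the mean weight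
    times [n], so that the windows are [[eps * a ^ eta, a ^ eta / eps]].

    Maximizing the exponent.  Put [S j] for the sum of the coordinates of
    [beta j].  The separation of a pair [i < j] satisfies
    [d * pair_scale beta i j >= S j], and it is also at least the average of
    [S i] and [S j] when [i] is not the first vertex.  The pair contributes
    [gamma * min (x, 0)], where [x = alpha i + alpha j - 1 - d * pair_scale].
    Replacing this by the larger [l * x], with the same [0 < l < gamma] for all
    pairs, bounds the exponent by an affine function of the sum of the
    [alpha i] and of the sum of the [S j].  With [l = 2 / k] the coefficient of
    the second sum vanishes and, when [k < 2 / (3 - tau)], that of the first is
    negative: the maximum is 1.  With [l = (tau - 1) / (k - 1)] the coefficient
    of the first sum vanishes and, when [k > 2 / (3 - tau)], that of the second
    is positive: the maximum is [k * (3 - tau) / 2].  As [0 < l < gamma], what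
    is lost on a pair is at least a multiple of [|x|]; hence equality forces
    every [x] to vanish, which gives the uniqueness ([is_argmax_star]).

    First moment.  The vertex set is cut into [k] classes of [n %/ k] vertices,
    and only the lists with one vertex in each class are counted.  Around a
    grid of points of the torus (the cells) the first vertex is confined to
    a small box, and the other vertices of the list to boxes shifted to the right
    by a distance of the prescribed order.  All the constraints of [in_M] then hold,
    no displacement wraps around the torus, and the events are rectangles, whose
    probabilities are products by independence.  On these events an edge
    has conditional probability at least
    [eps ^ (2 * gamma) * a ^ (gamma * min (x, 0))], and summing over the lists
    and the cells gives the lower bound on the expectation
    ([expected_clique_count_ge_powR]).

    Concentration at the maximum.  There all the [x] vanish, so the edges have
    conditional probability bounded below, and the cells can be chosen with
    disjoint boxes at every place.  Two applications of Chebyshev's inequality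
    are combined pointwise: one for the number of lists in their boxes
    (a function of weights and positions), one for the edges given weights and
    positions, under the finite product of Bernoulli laws
    ([bernoulli_chebyshev]).  In both, only pairs of lists with a common vertex
    contribute.  Two such lists lie in the same cell, and
    they are rarer than all pairs by a power of [n] ([overlap_count_le]). *)

(** * Maximizing the exponent *)

Section exponent_max.
Context {R : realType}.

Lemma minr0_le_affine (g l e x : R) : 0 <= e -> e <= l -> l <= g - e ->
  g * Num.min x 0 <= l * x - e * `|x|.
Proof.
move=> e0 el lg; rewrite minEle; case: (leP x 0) => x0.
  by rewrite ler0_norm//; nra.
by rewrite mulr0 gtr0_norm//; nra.
Qed.

Lemma sum_ltn_pair (n : nat) (a : 'I_n -> R) :
  \sum_(i < n) \sum_(j < n | (i < j)%N) (a i + a j) = n.-1%:R * \sum_i a i.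
Proof.
under eq_bigr do rewrite big_split /=.
rewrite big_split /=.
rewrite [X in _ + X](exchange_big_dep predT) //= -big_split /= mulr_sumr.
apply: eq_bigr => i _.
transitivity (\sum_(j | j \in predC1 i) a i); last first.
  by rewrite sumr_const cardC1 card_ord [RHS]mulr_natl.
rewrite [RHS](bigID (fun j : 'I_n => (i < j)%N)) /=; congr (_ + _).
  by apply: eq_bigl => j; rewrite inE -val_eqE /=; case: ltngtP.
by apply: eq_bigl => j; rewrite inE -val_eqE /=; case: ltngtP.
Qed.

Lemma sum_ltn_pair_recl (n : nat) (F : 'I_n.+1 -> 'I_n.+1 -> R) :
  \sum_(i < n.+1) \sum_(j < n.+1 | (i < j)%N) F i j =
  \sum_(j < n) F ord0 (lift ord0 j) +
  \sum_(i < n) \sum_(j < n | (i < j)%N) F (lift ord0 i) (lift ord0 j).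
Proof.
rewrite big_ord_recl; congr (_ + _).
  by rewrite big_mkcond /= big_ord_recl /= add0r.
apply: eq_bigr => i _.
by rewrite big_mkcond /= big_ord_recl /= add0r [RHS]big_mkcond.
Qed.

(** The largest of the coordinate exponents of [i] and [j], where the first
    vertex has exponent [-oo]: it governs the distance between these two vertices. *)
Definition pair_scale (d m : nat) (beta : 'I_m -> 'I_d -> R)
    (i j : 'I_m.+1) : R :=
  fine (\big[maxe/-oo%E]_(h < d) maxe (ext_beta beta i h) (ext_beta beta j h)).

Lemma pair_scaleC (d m : nat) (beta : 'I_m -> 'I_d -> R) (i j : 'I_m.+1) :
  pair_scale beta i j = pair_scale beta j i.
Proof. by rewrite /pair_scale; under eq_bigr do rewrite maxC. Qed.

Lemma ext_beta_lift (d m : nat) (beta : 'I_m -> 'I_d -> R) (i : 'I_m) h :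
  ext_beta beta (lift ord0 i) h = (beta i h)%:E.
Proof. by rewrite /ext_beta liftK. Qed.

Lemma ext_beta_lty (d m : nat) (beta : 'I_m -> 'I_d -> R) (i : 'I_m.+1) h :
  (ext_beta beta i h < +oo)%E.
Proof. by rewrite /ext_beta; case: unlift => [a|] //; rewrite ltry. Qed.

Lemma pair_scale_ge (d m : nat) (beta : 'I_m -> 'I_d -> R) (i : 'I_m)
  (j : 'I_m.+1) (h : 'I_d) : beta i h <= pair_scale beta (lift ord0 i) j.
Proof.
set M := (\big[maxe/-oo%E]_(h < d)
   maxe (ext_beta beta (lift ord0 i) h) (ext_beta beta j h))%E.
have leM : ((beta i h)%:E <= M)%E.
  rewrite /M; apply: le_trans (le_bigmax _ _ h).
  by rewrite ext_beta_lift le_max lexx.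
have ltM : (M < +oo)%E.
  by apply: bigmax_lt => // h' _; rewrite gt_max !ext_beta_lty.
rewrite -lee_fin /pair_scale -/M fineK//.
by rewrite fin_numE (lt_eqF ltM) andbT gt_eqF// (lt_le_trans _ leM)// ltNyr.
Qed.

Lemma pair_scale_ger (d m : nat) (beta : 'I_m -> 'I_d -> R) (i : 'I_m)
  (j : 'I_m.+1) (h : 'I_d) : beta i h <= pair_scale beta j (lift ord0 i).
Proof. by rewrite pair_scaleC pair_scale_ge. Qed.

Lemma pair_scale_const (d m : nat) (b : R) (i j : 'I_m.+1) : (0 < d)%N ->
  (i < j)%N -> pair_scale (fun (_ : 'I_m) (_ : 'I_d) => b) i j = b.
Proof.
case: d => // d _ ij; set be := (fun _ _ => b).
have [j' jE] : exists j', j = lift ord0 j'.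
  by case: (unliftP ord0 j) ij => [j' ->|->//] _; exists j'.
apply/le_anti/andP; split; last first.
  by rewrite jE; exact: (pair_scale_ger be j' i ord0).
rewrite /pair_scale.
have le_b : (\big[maxe/-oo%E]_(h < d.+1)
    maxe (ext_beta be i h) (ext_beta be j h) <= b%:E)%E.
  apply: bigmax_le => [|h _]; first by rewrite leNye.
  rewrite jE ext_beta_lift ge_max lexx andbT.
  by rewrite /ext_beta; case: unlift => [?|]//; rewrite leNye.
rewrite -lee_fin fineK// fin_numE (lt_eqF (le_lt_trans le_b (ltry b))) andbT.
rewrite gt_eqF//; apply: (@lt_le_trans _ _ b%:E); first exact: ltNyr.
rewrite jE (_ : b%:E = ext_beta be (lift ord0 j') ord0); last first.
  by rewrite ext_beta_lift.
apply: le_trans (le_bigmax _ _ ord0).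
by rewrite le_max lexx orbT.
Qed.

Section bounds.
Variables (tau gamma : R) (d m : nat).
Hypotheses (htau : 2 < tau < 3) (hgamma : 1 < gamma) (d_gt0 : (0 < d)%N)
  (m_gt0 : (0 < m)%N).

Let gap (alpha : 'I_m.+1 -> R) (beta : 'I_m -> 'I_d -> R) i j :=
  alpha i + alpha j - 1 - d%:R * pair_scale beta i j.

(** Each term [gamma * min (gap, 0)] is replaced by the bound of
    [minr0_le_affine].  The separation of a pair is bounded below by the
    coordinate sum of its second vertex, and by the average of the two
    coordinate sums, which is additive over the pairs. *)
Lemma exponent_le_affine (l e : R) (alpha : 'I_m.+1 -> R)
    (beta : 'I_m -> 'I_d -> R) : 0 <= e -> e <= l -> l <= gamma - e ->
  exponent tau gamma alpha beta +
    e * \sum_(i < m.+1) \sum_(j < m.+1 | (i < j)%N) `|gap alpha beta i j| <=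
  m.+1%:R - l * (m%:R * m.+1%:R / 2) + (l * m%:R + 1 - tau) * (\sum_i alpha i)
  + (1 - l * m.+1%:R / 2) * \sum_i \sum_h beta i h.
Proof.
move=> e0 el lg; pose S i := \sum_h beta i h.
have S_le (i : 'I_m) j : S i <= d%:R * pair_scale beta (lift ord0 i) j.
  rewrite mulr_natl -[X in _ *+ X]card_ord -sumr_const.
  by apply: ler_sum => h _; exact: pair_scale_ge.
have sum_scale : m.+1%:R / 2 * \sum_i S i <=
    \sum_(i < m.+1) \sum_(j < m.+1 | (i < j)%N) d%:R * pair_scale beta i j.
  rewrite sum_ltn_pair_recl.
  have h1 : \sum_i S i <=
      \sum_(j < m) d%:R * pair_scale beta ord0 (lift ord0 j).
    by apply: ler_sum => j _; rewrite pair_scaleC.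
  have h2 : \sum_(i < m) \sum_(j < m | (i < j)%N) (S i / 2 + S j / 2) <=
     \sum_(i < m) \sum_(j < m | (i < j)%N)
       d%:R * pair_scale beta (lift ord0 i) (lift ord0 j).
    apply: ler_sum => i _; apply: ler_sum => j _.
    have := S_le i (lift ord0 j); have := S_le j (lift ord0 i).
    by rewrite [in X in X -> _]pair_scaleC; lra.
  apply: le_trans (lerD h1 h2); rewrite (sum_ltn_pair (fun i => S i / 2)).
  have -> : m.-1%:R = m%:R - 1 :> R 
    by rewrite -[in RHS](prednK m_gt0) -natr1 addrK.
  by rewrite -mulr_suml -natr1; lra.
have pen : \sum_(i < m.+1) \sum_(j < m.+1 | (i < j)%N)
      gamma * Num.min (gap alpha beta i j) 0 <=
    l * (m%:R * (\sum_i alpha i) - m%:R * m.+1%:R / 2 - m.+1%:R / 2 * \sum_i S i)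
    - e * \sum_(i < m.+1) \sum_(j < m.+1 | (i < j)%N) `|gap alpha beta i j|.
  apply: (@le_trans _ _ (\sum_(i < m.+1) \sum_(j < m.+1 | (i < j)%N)
      (l * ((alpha i - 1/2) + (alpha j - 1/2)) -
       l * (d%:R * pair_scale beta i j) - e * `|gap alpha beta i j|))).
    apply: ler_sum => i _; apply: ler_sum => j _.
    apply: le_trans (minr0_le_affine _ e0 el lg) _.
    by rewrite lerD2r /gap le_eqVlt; apply/orP; left; apply/eqP; field.
  under eq_bigr do rewrite !big_split /= !sumrN -!mulr_sumr.
  rewrite !big_split /= !sumrN -!mulr_sumr lerD2r -mulrBr ler_wpM2l//.
    exact: le_trans el.
  rewrite (sum_ltn_pair (fun i => alpha i - 1 / 2)) big_split /= sumr_const.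
  rewrite card_ord -[_ *+ m.+1]mulr_natl.
  move: sum_scale; under [X in _ <= X -> _]eq_bigr do rewrite -mulr_sumr.
  by rewrite -mulr_sumr; lra.
move: pen; rewrite /exponent /gap /S /pair_scale.
set A := \sum_i alpha i; set B := \sum_i \sum_h _.
set C := \sum_i \sum_(j | _) _.
set D := \sum_i \sum_(j | _) `|_|.
set C' := (X in X <= _ -> _); rewrite -/C'.
by move=> pen; lra.
Qed.

(** The maximal value of the exponent. *)
Let starE := if 2 / (3 - tau) < m.+1%:R then m.+1%:R * (3 - tau) / 2 else 1.

Lemma exponent_star :
  exponent tau gamma (@alpha_star R tau m) (@beta_star R tau d m) = starE.
Proof.
have [t2 t3] := andP htau.
have dn0 : d%:R != 0 :> R by rewrite pnatr_eq0 -lt0n.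
rewrite /exponent /alpha_star /beta_star /starE.
set c := (2 / (3 - tau) < m.+1%:R).
rewrite [X in _ + X]big1 ?addr0; last first.
  move=> i _; apply: big1 => j ij.
  rewrite -/(pair_scale (fun _ _ => if c then 0 else - (1 / d%:R)) i j).
  rewrite pair_scale_const// (_ : Num.min _ 0 = 0) ?mulr0//.
  apply/min_idPr; case: c; first by rewrite mulr0; lra.
  by rewrite mulrN mulrA mulr1 divff//; lra.
rewrite !sumr_const !card_ord.
rewrite -[_ *+ m.+1]mulr_natl -[_ *+ m]mulr_natl -[_ *+ d]mulr_natl.
case: c; first by field.
by rewrite -natr1; field.
Qed.

Lemma exponent_le_star (alpha : 'I_m.+1 -> R) (beta : 'I_m -> 'I_d -> R) :
  m.+1%:R <> 2 / (3 - tau) -> in_domain alpha beta ->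
  exponent tau gamma alpha beta <= starE /\
  (exponent tau gamma alpha beta = starE ->
   alpha = @alpha_star R tau m /\ beta = @beta_star R tau d m).
Proof.
move=> /eqP kneq [al0 be0]; have [t2 t3] := andP htau.
have k2 : 2 <= m.+1%:R :> R by rewrite ler_nat ltnS.
have mE : m%:R = m.+1%:R - 1 :> R by rewrite -natr1 addrK.
have dn0 : d%:R != 0 :> R by rewrite pnatr_eq0 -lt0n.
set k := m.+1%:R : R in kneq k2 mE *.
set A := \sum_i alpha i; set B := \sum_i \sum_h beta i h.
have A0 : 0 <= A by exact: sumr_ge0.
have B0 : B <= 0 by apply: sumr_le0 => i _; apply: sumr_le0.
set p := \sum_(i < m.+1) \sum_(j < m.+1 | (i < j)%N) `|gap alpha beta i j|.
have p0 : 0 <= p by apply: sumr_ge0 => i _; apply: sumr_ge0.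
have gap0 (i j : 'I_m.+1) : (i < j)%N -> p = 0 -> gap alpha beta i j = 0.
  move=> ij /eqP; rewrite /p psumr_eq0; last by move=> *; apply: sumr_ge0.
  move=> /allP/(_ i (mem_index_enum _))/implyP/(_ isT).
  rewrite psumr_eq0// => /allP/(_ j (mem_index_enum _))/implyP/(_ ij).
  by rewrite normr_eq0 => /eqP.
rewrite /starE /alpha_star /beta_star; case: ltP => [kgt|].
- have k3 : 2 < k * (3 - tau) by rewrite ltr_pdivrMr in kgt => //; lra.
  have m2 : (1 < m)%N.
    rewrite ltnNge; apply/negP => m1; move: k3.
    have -> : k = 2 by rewrite /k; case: (m) m1 m_gt0 => [|[|]].
    by lra.
  (* This slope cancels the coefficient of the sum of the [alpha i]. *)
  pose l := (tau - 1) / m%:R; pose e := Num.min l (gamma - l).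
  have mr0 : 0 < m%:R :> R by rewrite ltr0n.
  have l0 : 0 < l by rewrite divr_gt0//; lra.
  have l1 : l < 1 by rewrite ltr_pdivrMr// mul1r mE; nra.
  have e0 : 0 < e by rewrite lt_min l0 subr_gt0 (lt_trans l1).
  have el : e <= l by rewrite ge_min lexx.
  have eg : l <= gamma - e by rewrite lerBrDl -lerBrDr ge_min lexx orbT.
  have := exponent_le_affine alpha beta (ltW e0) el eg.
  rewrite -/A -/B -/p -/k.
  have -> : l * m%:R + 1 - tau = 0 by rewrite divfK ?gt_eqF//; lra.
  have -> : l * (m%:R * k / 2) = (tau - 1) * k / 2 by rewrite /l; field; lra.
  have c0 : 0 < 1 - l * k / 2.
    rewrite /l; rewrite subr_gt0 ltr_pdivrMr// mulrAC ltr_pdivrMr// mE.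
    by lra.
  move=> le; split; first by have := mulr_ge0 (ltW e0) p0; nra.
  move=> eqf.
  have pE : p = 0 by have := mulr_ge0 (ltW e0) p0; nra.
  have BE : B = 0 by have := mulr_ge0 (ltW e0) p0; nra.
  have betaE : beta = fun _ _ => 0.
    apply/funext => i; apply/funext => h.
    have /eqP := BE; rewrite -oppr_eq0 /B -sumrN psumr_eq0; last first.
      by move=> *; rewrite oppr_ge0; apply: sumr_le0.
    move=> /allP/(_ i (mem_index_enum _))/implyP/(_ isT).
    rewrite -sumrN psumr_eq0; last by move=> *; rewrite oppr_ge0.
    move=> /allP/(_ h (mem_index_enum _))/implyP/(_ isT).
    by rewrite oppr_eq0 => /eqP.
  split=> //.
  have pair1 (i j : 'I_m.+1) : (i < j)%N -> alpha i + alpha j = 1.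
    move=> ij; have := gap0 i j ij pE.
    by rewrite /gap betaE pair_scale_const// mulr0; lra.
  (* As [k >= 3], there are three places; pairwise sums equal to 1 give 1/2. *)
  have m3 : (2 < m.+1)%N by rewrite ltnS.
  have a0 : alpha ord0 = 1 / 2.
    have := pair1 ord0 (Ordinal (ltnW m3)) isT.
    have := pair1 ord0 (Ordinal m3) isT.
    have := pair1 (Ordinal (ltnW m3)) (Ordinal m3) isT.
    by lra.
  apply/funext => i; case: (unliftP ord0 i) => [i' ->|->] //.
  by have := pair1 ord0 (lift ord0 i') isT; lra.
- rewrite le_eqVlt (negPf kneq) /= => klt.
  have k3 : k * (3 - tau) < 2 by rewrite ltr_pdivlMr in klt => //; lra.
  have k0 : 0 < k by lra.
  (* This slope cancels the coefficient of the sum of the [beta i h]. *)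
  pose l := 2 / k; pose e := Num.min l (gamma - l).
  have l0 : 0 < l by rewrite divr_gt0//; lra.
  have l1 : l <= 1 by rewrite ler_pdivrMr// mul1r.
  have e0 : 0 < e by rewrite lt_min l0 subr_gt0 (le_lt_trans l1).
  have el : e <= l by rewrite ge_min lexx.
  have eg : l <= gamma - e by rewrite lerBrDl -lerBrDr ge_min lexx orbT.
  have := exponent_le_affine alpha beta (ltW e0) el eg.
  rewrite -/A -/B -/p -/k.
  have -> : l * (m%:R * k / 2) = k - 1 by rewrite /l mE; field; lra.
  have -> : 1 - l * k / 2 = 0 by rewrite /l; field; lra.
  have c0 : l * m%:R + 1 - tau < 0.
    have -> : l * m%:R + 1 - tau = (k * (3 - tau) - 2) / k.
      by rewrite /l mE; field; lra.
    by rewrite pmulr_llt0 ?invr_gt0//; lra.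
  move=> le; split; first by have := mulr_ge0 (ltW e0) p0; nra.
  move=> eqf.
  have pE : p = 0 by have := mulr_ge0 (ltW e0) p0; nra.
  have AE : A = 0 by have := mulr_ge0 (ltW e0) p0; nra.
  have alE : alpha = fun=> 0.
    apply/funext => i; have /eqP := AE; rewrite /A psumr_eq0//.
    by move=> /allP/(_ i (mem_index_enum _))/implyP/(_ isT)/eqP.
  split=> //.
  have be_le (i : 'I_m) h : beta i h <= - (1 / d%:R).
    have := gap0 ord0 (lift ord0 i) isT pE; rewrite /gap alE => gE.
    have := pair_scale_ger beta i ord0 h.
    have -> : pair_scale beta ord0 (lift ord0 i) = - (1 / d%:R).
      by apply: (mulfI dn0); rewrite mulrN mulrA mulr1 divff//; lra.
    by [].
  have BE : \sum_i \sum_h (- (1 / d%:R) - beta i h) = 0.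
    apply/eqP; rewrite eq_le; apply/andP; split; last first.
      by apply: sumr_ge0 => i _; apply: sumr_ge0 => h _; rewrite subr_ge0.
    under eq_bigr do rewrite big_split /= sumrN sumr_const card_ord.
    rewrite big_split /= sumrN sumr_const card_ord.
    under [X in _ + X]eq_bigr do rewrite sumrN.
    rewrite [X in _ + X]sumrN -/B.
    rewrite -[_ *+ m]mulr_natl -[_ *+ d]mulr_natl.
    rewrite (_ : d%:R * (1 / d%:R) = 1); last by field.
    move: eqf; rewrite /exponent -/A -/B AE mulr0 addr0.
    set C := \sum_(i < _) \sum_(j | _) _; suff : C <= 0 by rewrite mE -/k; lra.
    apply: sumr_le0 => i _; apply: sumr_le0 => j _.
    by rewrite pmulr_rle0 ?ge_min ?lexx ?orbT//; lra.
  apply/funext => i; apply/funext => h.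
  move/eqP: BE; rewrite psumr_eq0; last first.
    by move=> *; apply: sumr_ge0 => *; rewrite subr_ge0.
  move=> /allP/(_ i (mem_index_enum _))/implyP/(_ isT).
  rewrite psumr_eq0; last by move=> *; rewrite subr_ge0.
  move=> /allP/(_ h (mem_index_enum _))/implyP/(_ isT).
  by rewrite subr_eq0 => /eqP.
Qed.

Lemma is_argmax_star (alpha : 'I_m.+1 -> R) (beta : 'I_m -> 'I_d -> R) :
  m.+1%:R <> 2 / (3 - tau) ->
  is_argmax tau gamma alpha beta <->
  alpha = @alpha_star R tau m /\ beta = @beta_star R tau d m.
Proof.
move=> kneq.
have star_dom : in_domain (@alpha_star R tau m) (@beta_star R tau d m).
  rewrite /alpha_star /beta_star; split => [i|i h]; case: ifP => _;
    by rewrite ?lexx ?divr_ge0 ?oppr_le0 ?divr_ge0.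
split=> [[dom max]|[-> ->]].
  have [le eqf] := exponent_le_star kneq dom; apply: eqf.
  by apply/le_anti; rewrite le -exponent_star max.
split=> // alpha' beta' dom; rewrite exponent_star.
by have [] := exponent_le_star kneq dom.
Qed.

End bounds.
End exponent_max.

(** * Independent Bernoulli variables on a finite index set *)

Section bernoulli.
Context {R : realType} {E : finType}.
Variable a : E -> R.

(** The probability of the configuration [e] when the coordinates are
    independent and coordinate [p] is [true] with probability [a p]. *)
Definition bernoulli_weight (e : {ffun E -> bool}) : R :=
  \prod_p (if e p then a p else 1 - a p).

(** All the coordinates in [F] are [true]. *)
Definition all_true (e : {ffun E -> bool}) (F : {set E}) : bool :=
  [forall p in F, e p].

Lemma all_trueU e F F' :
  all_true e (F :|: F') = all_true e F && all_true e F'.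
Proof.
apply/forall_inP/andP => [h|[/forall_inP h /forall_inP h'] p].
  by split; apply/forall_inP => p pF; apply: h; rewrite inE pF ?orbT.
by rewrite inE => /orP[/h|/h'].
Qed.

Lemma sum_bernoulli_weight_all_true F :
  \sum_e bernoulli_weight e * (all_true e F)%:R = \prod_(p in F) a p.
Proof.
transitivity (\sum_(e : {ffun E -> bool})
    \prod_p (if e p then a p else if p \in F then 0 else 1 - a p)).
  apply: eq_bigr => e _; have [eF|/forall_inPn[p pF /negPf ep]] :=
    boolP (all_true e F).
    rewrite mulr1; apply: eq_bigr => p _.
    case: ifP => // ep; case: ifP => // pF.
    by move/forall_inP/(_ p pF): eF; rewrite ep.
  by rewrite mulr0 [RHS](bigD1 p)//= ep pF mul0r.
rewrite -(bigA_distr_bigA (fun p (b : bool) =>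
  if b then a p else if p \in F then 0 else 1 - a p)).
rewrite [RHS]big_mkcond; apply: eq_bigr => p _.
by rewrite big_bool /=; case: ifP => _; rewrite ?addr0 // addrC subrK.
Qed.

Lemma sum_bernoulli_weight : \sum_e bernoulli_weight e = 1.
Proof.
transitivity (\prod_(p in finset.set0) a p); last first.
  by apply: big_pred0 => p; rewrite inE.
rewrite -sum_bernoulli_weight_all_true; apply: eq_bigr => e _.
rewrite (_ : all_true _ _) ?mulr1//.
by apply/forall_inP => p; rewrite inE.
Qed.

Hypothesis a01 : forall p, 0 <= a p <= 1.

Lemma bernoulli_weight_ge0 e : 0 <= bernoulli_weight e.
Proof.
by apply: prodr_ge0 => p _; have /andP[? ?] := a01 p;
   case: ifP; rewrite ?subr_ge0.
Qed.

Section chebyshev.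
Variables (I : finType) (F : I -> {set E}) (c : {pred I}).

Let Y e : R := \sum_(v in c) (all_true e (F v))%:R.
Let prF v := \prod_(p in F v) a p.

Let prF01 v : 0 <= prF v <= 1.
Proof.
apply/andP; split; first by apply: prodr_ge0 => p _; have /andP[] := a01 p.
by apply: Num.Theory.prodr_ile1 => p _; exact: a01.
Qed.

Let sumY : \sum_e bernoulli_weight e * Y e = \sum_(v in c) prF v.
Proof.
under eq_bigr do rewrite mulr_sumr.
rewrite exchange_big; apply: eq_bigr => v _.
exact: sum_bernoulli_weight_all_true.
Qed.

Let sumY2 : \sum_e bernoulli_weight e * Y e ^+ 2 =
  \sum_(u in c) \sum_(v in c) \prod_(p in F u :|: F v) a p.
Proof.
under eq_bigr do rewrite expr2 /Y mulr_suml mulr_sumr.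
rewrite exchange_big; apply: eq_bigr => u _.
under eq_bigr do rewrite mulr_sumr mulr_sumr.
rewrite exchange_big; apply: eq_bigr => v _.
rewrite -sum_bernoulli_weight_all_true; apply: eq_bigr => e _.
by rewrite all_trueU -mulnb natrM.
Qed.

(** Chebyshev's inequality for the number of the sets [F v], [v] in [c], all of
    whose coordinates are [true]: only the pairs of sets that meet contribute
    to the variance. *)
Lemma bernoulli_chebyshev (q x : R) :
  (forall v, v \in c -> q <= prF v) -> x < q * #|c|%:R ->
  (\sum_(e | Y e <= x) bernoulli_weight e) * (q * #|c|%:R - x) ^+ 2 <=
  \sum_(u in c) \sum_(v in c) (~~ [disjoint F u & F v])%:R.
Proof.
move=> qle xlt; pose mu := \sum_(v in c) prF v.
have mule : q * #|c|%:R <= mu.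
  by rewrite mulr_natr -sumr_const; exact: ler_sum.
have var : \sum_e bernoulli_weight e * (Y e - mu) ^+ 2 <=
    \sum_(u in c) \sum_(v in c) (~~ [disjoint F u & F v])%:R.
  have -> : \sum_e bernoulli_weight e * (Y e - mu) ^+ 2 =
      \sum_e bernoulli_weight e * Y e ^+ 2 - mu ^+ 2.
    transitivity (\sum_e (bernoulli_weight e * Y e ^+ 2 -
      (mu *+ 2 * (bernoulli_weight e * Y e) - mu ^+ 2 * bernoulli_weight e))).
      by apply: eq_bigr => e _; ring.
    rewrite !big_split /= !sumrN big_split /= sumrN -!mulr_sumr.
    by rewrite sumY sum_bernoulli_weight -/mu; ring.
  rewrite sumY2 expr2 {1}/mu mulr_suml -sumrB; apply: ler_sum => u _.
  rewrite mulr_sumr -sumrB; apply: ler_sum => v _.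
  have [dis|_] /= := boolP [disjoint F u & F v].
    rewrite (eq_bigl [predU F u & F v]) ?bigU ?subrr// => p.
    by rewrite !inE.
  have /andP[u0 _] := prF01 u; have /andP[v0 _] := prF01 v.
  rewrite lerBlDr (@le_trans _ _ 1)//; last by rewrite lerDl mulr_ge0.
  by apply: Num.Theory.prodr_ile1 => p _; exact: a01.
apply: le_trans var; rewrite mulr_suml [leRHS](bigID (fun e => Y e <= x)) /=.
rewrite -[leLHS]addr0 lerD//; last first.
  by apply: sumr_ge0 => e _; rewrite mulr_ge0 ?bernoulli_weight_ge0 ?sqr_ge0.
apply: ler_sum => e Yx; rewrite ler_wpM2l ?bernoulli_weight_ge0//.
by rewrite -(sqrrN (Y e - mu)) opprB lerXn2r ?nnegrE//; lra.
Qed.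

End chebyshev.
End bernoulli.

(** * Measurability *)

Section measurability.
Context d {T : measurableType d}.

Lemma measurable_fin_bigcap (I : finType) (A : I -> set T) :
  (forall i, measurable (A i)) -> measurable (\bigcap_i A i).
Proof. by move=> mA; apply: fin_bigcap_measurable. Qed.

Lemma measurable_fin_bigcup (I : finType) (D : set I) (A : I -> set T) :
  (forall i, D i -> measurable (A i)) -> measurable (\bigcup_(i in D) A i).
Proof. by move=> mA; apply: fin_bigcup_measurable. Qed.

(** An event that depends only on which members of a finite family of
    measurable events occur is measurable. *)
Lemma measurable_finite_pattern (I : finType) (b : I -> T -> bool)
    (Phi : {ffun I -> bool} -> bool) :
  (forall i, measurable [set t | b i t]) ->
  measurable [set t | Phi [ffun i => b i t]].
Proof.
move=> mb.
rewrite (_ : [set t | _] = \bigcup_(f in [set f | Phi f])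
    \bigcap_i [set t | b i t = f i]).
  apply: measurable_fin_bigcup => f _; apply: measurable_fin_bigcap => i.
  case: (f i); first exact: mb.
  rewrite (_ : [set t | _] = ~` [set t | b i t]).
    by apply: measurableC; exact: mb.
  by apply/seteqP; split => t /=; [move=> ->|move=> /negP/negPf].
apply/seteqP; split => [t /= Phit|t [f /= Phif fE]].
  by exists [ffun i => b i t] => //= i _ /=; rewrite ffunE.
by rewrite (_ : [ffun i => b i t] = f)//; apply/ffunP => i; rewrite ffunE fE.
Qed.

Lemma measurable_forallb (I : finType) (b : I -> T -> bool) :
  (forall i, measurable [set t | b i t]) ->
  measurable [set t | [forall i, b i t]].
Proof.
move=> mb.
have := @measurable_finite_pattern I b (fun f => [forall i, f i]) mb.
by congr measurable; apply/seteqP; split => t /= /forallP h; apply/forallP => i;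
   have := h i; rewrite ffunE.
Qed.

Lemma measurable_existsb (I : finType) (b : I -> T -> bool) :
  (forall i, measurable [set t | b i t]) ->
  measurable [set t | [exists i, b i t]].
Proof.
move=> mb.
have := @measurable_finite_pattern I b (fun f => [exists i, f i]) mb.
by congr measurable; apply/seteqP; split => t /= /existsP[i h];
   apply/existsP; exists i; move: h; rewrite ffunE.
Qed.

Lemma measurable_andb (b c : T -> bool) :
  measurable [set t | b t] -> measurable [set t | c t] ->
  measurable [set t | b t && c t].
Proof.
move=> mb mc; rewrite (_ : [set t | _] = [set t | b t] `&` [set t | c t]).
  exact: measurableI.
by apply/seteqP; split => t /= => [/andP[]|[-> ->]].
Qed.

Lemma measurable_cstb (b : bool) : measurable [set t : T | b].
Proof.
case: b; first by rewrite (_ : [set _ | _] = setT)//; apply/seteqP; split.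
by rewrite (_ : [set _ | _] = set0)//; apply/seteqP; split.
Qed.

Lemma measurable_implyb (b : bool) (c : T -> bool) :
  measurable [set t | c t] -> measurable [set t | b ==> c t].
Proof. by case: b => // _; exact: (measurable_cstb true). Qed.

Context {R : realType}.

Lemma measurable_mem_itv (f : T -> R) (i : interval R) :
  measurable_fun setT f -> measurable [set t | f t \in i].
Proof.
move=> mf; rewrite (_ : [set t | _] = setT `&` f @^-1` [set` i]).
  exact: mf.
by rewrite setTI.
Qed.

Lemma measurable_circle_dist (f g : T -> R) :
  measurable_fun setT f -> measurable_fun setT g ->
  measurable_fun setT (fun t => circle_dist (f t) (g t)).
Proof.
move=> mf mg; have mfg : measurable_fun setT (fun t => `|f t - g t|).
  by apply: measurableT_comp => //; exact: measurable_funB.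
by apply: measurable_minr => //; exact: measurable_funB.
Qed.

Lemma measurable_torus_dist k (x y : 'I_k -> T -> R) :
  (forall h, measurable_fun setT (x h)) ->
  (forall h, measurable_fun setT (y h)) ->
  measurable_fun setT (fun t => torus_dist (x ^~ t) (y ^~ t)).
Proof.
move=> mx my; rewrite /torus_dist; elim: (index_enum _) => [|h s IH].
  by under eq_fun do rewrite big_nil; exact: measurable_cst.
under eq_fun do rewrite big_cons.
by apply: measurable_maxr => //; exact: measurable_circle_dist.
Qed.

Lemma torus_dist_ge0 k (x y : 'I_k -> R) : 0 <= torus_dist x y.
Proof. by rewrite /torus_dist; exact: bigmax_ge_id. Qed.

Lemma measurable_conn_prob (tau w0 gamma : R) (k n : nat)
    (wu wv : T -> R) (x y : 'I_k -> T -> R) :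
  0 <= mean_weight tau w0 ->
  measurable_fun setT wu -> measurable_fun setT wv ->
  (forall h, measurable_fun setT (x h)) ->
  (forall h, measurable_fun setT (y h)) ->
  measurable_fun setT (fun t =>
    conn_prob tau w0 gamma n (wu t) (wv t) (x ^~ t) (y ^~ t)).
Proof.
move=> mu0 mwu mwv mx my; rewrite /conn_prob.
have mD := measurable_torus_dist mx my.
apply: measurable_fun_ifT => //; first exact: measurable_fun_eqr.
apply: measurable_minr => //.
apply: (measurableT_comp (measurable_powR gamma)) => //.
apply: measurable_funM; first exact: measurable_funM.
rewrite (_ : (fun t => _) = fun t => (n%:R * mean_weight tau w0 *
    torus_dist (x ^~ t) (y ^~ t) ^+ k) `^ (-1)); last first.
  apply/funext => t.
  rewrite powR_inv1//; apply: mulr_ge0; first exact: mulr_ge0.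
  by rewrite exprn_ge0// torus_dist_ge0.
apply: (measurableT_comp (measurable_powR _)) => //.
by apply: measurable_funM => //; exact: measurable_funX.
Qed.

Lemma conn_prob_bounds (tau w0 gamma : R) (k n : nat) (wu wv : R)
    (x y : 'I_k -> R) : 0 <= conn_prob tau w0 gamma n wu wv x y <= 1.
Proof.
rewrite /conn_prob; case: ifP => _; first by rewrite ler01 lexx.
by rewrite le_min powR_ge0 ler01 ge_min lexx orbT.
Qed.

End measurability.

(** * The law of the edges given the attributes *)

Section graph_law.
Context {R : realType} {tau w0 gamma : R} {d n : nat} {disp : measure_display}
  {T : measurableType disp} {P : probability T R}.
Variable G : girg tau w0 gamma d n P.
Hypothesis mean_ge0 : 0 <= mean_weight tau w0.

Lemma attribute_preimage_sigma s (A : set R) :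
  measurable A -> sigma_of (attribute G) (attribute G s @^-1` A).
Proof. by move=> mA; apply: sub_sigma_algebra; exists s, A. Qed.

Lemma sigma_of_measurable B : sigma_of (attribute G) B -> measurable B.
Proof.
move: B; apply: smallest_sub; first exact: sigma_algebra_measurable.
by move=> _ [s [A mA ->]]; exact: measurable_funPTI.
Qed.

(** The adjacency relation, recorded on the ordered pairs [u < v] and [false]
    on all others. *)
Definition edge_config (t : T) : {ffun 'I_n * 'I_n -> bool} :=
  [ffun p : 'I_n * 'I_n => (p.1 < p.2)%N && adj G t p.1 p.2].

(** The conditional probability that the coordinate [p] of [edge_config] is
    [true]. *)
Definition config_prob (t : T) (p : 'I_n * 'I_n) : R :=
  if (p.1 < p.2)%N then edge_prob G p.1 p.2 t else 0.

Lemma config_prob01 t p : 0 <= config_prob t p <= 1.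
Proof.
by rewrite /config_prob; case: ifP => _; rewrite ?conn_prob_bounds// lexx ler01.
Qed.

Lemma config_law B e : sigma_of (attribute G) B ->
  P (B `&` [set t | edge_config t = e]) =
  (\int[P]_(t in B) (bernoulli_weight (config_prob t) e)%:E)%E.
Proof.
move=> sB; have [supp|/forallPn[p]] :=
    boolP [forall p, e p ==> (p.1 < p.2)%N]; last first.
  rewrite negb_imply => /andP[ep lep].
  rewrite (_ : [set t | _] = set0); last first.
    apply/seteqP; split => // t /= eE.
    by move: ep; rewrite -eE ffunE (negPf lep).
  rewrite setI0 measure0; under eq_integral => t _.
    rewrite /bernoulli_weight (bigD1 p)//= ep /config_prob (negPf lep) mul0r.
    over.
  by rewrite integral0.
rewrite (_ : [set t | _] = [set t | forall u v : 'I_n, (u < v)%N ->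
    adj G t u v = e (u, v)]); last first.
  apply/seteqP; split => t /= => [<- u v uv|h]; first by rewrite ffunE /= uv.
  apply/ffunP => -[u v]; rewrite ffunE /=.
  have [uv|uv] /= := boolP (u < v)%N; first exact: h.
  by have := forallP supp (u, v); rewrite (negPf uv) implybF => /negPf.
rewrite (@adj_conditional_law _ _ _ _ _ _ _ _ _ G (fun u v => e (u, v)) B sB).
apply: eq_integral => t _; congr (_%:E).
rewrite pair_big_dep big_mkcond /=.
apply: eq_bigr => -[u v] _ /=; rewrite /config_prob /=.
case: ifP => // uv.
by have := forallP supp (u, v); rewrite /= uv implybF => /negPf ->; rewrite subr0.
Qed.

Lemma measurable_config_prob p : measurable_fun setT (config_prob ^~ p).
Proof.
rewrite /config_prob; case: (p.1 < p.2)%N; last exact: measurable_cst.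
exact: measurable_conn_prob.
Qed.

Lemma measurable_bernoulli_weight e :
  measurable_fun setT (fun t => bernoulli_weight (config_prob t) e).
Proof.
rewrite /bernoulli_weight; elim: (index_enum _) => [|p s IH].
  by under eq_fun do rewrite big_nil; exact: measurable_cst.
under eq_fun do rewrite big_cons.
apply: measurable_funM => //; case: (e p); first exact: measurable_config_prob.
by apply: measurable_funB => //; exact: measurable_config_prob.
Qed.

Lemma measurable_edge_config e : measurable [set t | edge_config t = e].
Proof.
rewrite (_ : [set t | _] =
    \bigcap_(p : 'I_n * 'I_n) [set t | ((p.1 < p.2)%N && adj G t p.1 p.2) = e p]).
  apply: measurable_fin_bigcap => p.
  have mp : measurable [set t | (p.1 < p.2)%N && adj G t p.1 p.2].
    by apply: measurable_andb; [exact: measurable_cstb | exact: adj_measurable].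
  case: (e p); first exact: mp.
  rewrite (_ : [set t | _] = ~` [set t | (p.1 < p.2)%N && adj G t p.1 p.2]).
    exact: measurableC.
  by apply/seteqP; split => t /=; [move=> ->|move=> /negP/negPf].
apply/seteqP; split => [t /= <- p _ /=|t h]; first by rewrite ffunE.
by apply/ffunP => p; rewrite ffunE; exact: (h p).
Qed.

(** The probability of an event on the attributes and the edges is the mean,
    over the attributes, of its probability under the product of the Bernoulli
    laws of the edges. *)
Lemma disintegration (B : {ffun 'I_n * 'I_n -> bool} -> set T) :
  (forall e, sigma_of (attribute G) (B e)) ->
  P [set t | B (edge_config t) t] =
  (\int[P]_t (\sum_e bernoulli_weight (config_prob t) e * \1_(B e) t)%:E)%E.
Proof.
move=> sB; have mB e := sigma_of_measurable (sB e).
have mI e : measurable (B e `&` [set t | edge_config t = e]).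
  by apply: measurableI => //; exact: measurable_edge_config.
have w_ge0 e t := bernoulli_weight_ge0 (config_prob01 t) e.
set S := [set t | _].
have mS : measurable S.
  rewrite (_ : S = \bigcup_e (B e `&` [set t | edge_config t = e])).
    exact: measurable_fin_bigcup.
  apply/seteqP; split => t /=; first by move=> Bt; exists (edge_config t).
  by move=> [e _ [Be eE]]; rewrite /S /= eE.
transitivity (\sum_e P (B e `&` [set t | edge_config t = e]))%E.
  transitivity (\int[P]_t
      (\sum_e (\1_(B e `&` [set t | edge_config t = e]) t)%:E))%E.
    rewrite -(setIT S) -integral_indic//; apply: eq_integral => t _.
    rewrite sumEFin; congr (_%:E).
    rewrite (bigD1 (edge_config t))//= big1 => [|e].
      rewrite addr0 !indicE in_setI; congr (_%:R).
      by rewrite [X in _ && X]mem_set ?andbT.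
    move=> /eqP ne; rewrite indicE memNset// => -[_ /= eE].
    by rewrite eE in ne.
  rewrite ge0_integral_sum//.
  - by apply: eq_bigr => e _; rewrite integral_indic// setIT.
  - by move=> e; apply/measurable_EFinP; exact: measurable_indic.
under [RHS]eq_integral do rewrite -sumEFin.
rewrite ge0_integral_sum//.
- apply: eq_bigr => e _; rewrite config_law// [LHS]integral_mkcond.
  apply: eq_integral => t _; rewrite patchE indicE.
  by case: ifP => _; rewrite ?mulr1 ?mulr0.
- move=> e; apply/measurable_EFinP; apply: measurable_funM.
    exact: measurable_bernoulli_weight.
  exact: measurable_indic.
- by move=> e t _; rewrite lee_fin mulr_ge0.
Qed.
End graph_law.

(** * The law of the attributes *)

Section interval_probabilities.
Context {R : realType}.

Lemma uniform_prob_itvoc (a b : R) : 0 <= a -> a <= b -> b <= 1 ->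
  uniform_prob (@ltr01 R) `]a, b]%classic = (b - a)%:E.
Proof.
move=> a0 ab b1; rewrite /uniform_prob.
rewrite (eq_integral (fun=> 1%E)); last first.
  move=> x; rewrite inE /= in_itv /= => /andP[ax xb].
  rewrite /uniform_pdf (le_trans a0 (ltW ax)) (le_trans xb b1) /=.
  by rewrite subr0 invr1.
rewrite integral_cst//= mul1e lebesgue_measure_itv /= lte_fin.
case: ltP => [_|ba]; first by rewrite EFinB.
by rewrite (_ : a = b) ?subrr//; apply/le_anti/andP.
Qed.

Context {disp : measure_display} {T : measurableType disp}
  {P : probability T R}.

Lemma ccdf_itvoc (X : {RV P >-> R}) (a b : R) : a <= b ->
  P (X @^-1` `]a, b]%classic) = (ccdf X a - ccdf X b)%E.
Proof.
move=> ab; rewrite /ccdf /distribution /pushforward.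
have -> : X @^-1` `]a, +oo[%classic =
    X @^-1` `]a, b]%classic `|` X @^-1` `]b, +oo[%classic.
  apply/seteqP; split => t /=; rewrite !in_itv /= !andbT.
    by move=> at'; case: (leP (X t) b) => h; [left; rewrite at'|right].
  by case=> [/andP[]//|]; exact: le_lt_trans.
rewrite measureU//.
- by rewrite addeK// fin_num_measure//; exact: measurable_funPTI.
- exact: measurable_funPTI.
- exact: measurable_funPTI.
- apply/seteqP; split => t //= []; rewrite !in_itv /= andbT => /andP[_ h1] h2.
  by move: (le_lt_trans h1 h2); rewrite ltxx.
Qed.

End interval_probabilities.

Section boxes.
Context {R : realType} {tau w0 gamma : R} {d n : nat} {disp : measure_display}
  {T : measurableType disp} {P : probability T R}.
Variable G : girg tau w0 gamma d n P.

(** The event that the weight of [u] lies in [c.1] and that, for every [h], the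
    [h]-th coordinate of its position lies in [c.2 h]. *)
Definition vertex_box (u : 'I_n) (c : set R * ('I_d -> set R)) : set T :=
  [set t | c.1 (weight G u t) /\ forall h, c.2 h (position G u h t)].

(** Boxes whose factors are all measurable. *)
Definition measurable_box (c : set R * ('I_d -> set R)) : Prop :=
  measurable c.1 /\ forall h, measurable (c.2 h).

Let spec (C : 'I_n -> set R * ('I_d -> set R)) (s : 'I_n + 'I_n * 'I_d) : set R :=
  match s with inl u => (C u).1 | inr (u, h) => (C u).2 h end.

Let box_spec C : \bigcap_u vertex_box u (C u) =
  \bigcap_s (attribute G s @^-1` spec C s).
Proof.
apply/seteqP; split => t /= h.
  by move=> [u|[u i]] _ /=; have [h1 h2] := h u I; [exact: h1|exact: h2].
by move=> u _; split; [exact: (h (inl u) I)|move=> i; exact: (h (inr (u, i)) I)].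
Qed.

Let box_prod C : (forall u, measurable_box (C u)) ->
  P (\bigcap_u vertex_box u (C u)) =
  (\prod_u (P (weight G u @^-1` (C u).1) *
            \prod_h P (position G u h @^-1` (C u).2 h)))%E.
Proof.
move=> mC; rewrite box_spec attribute_independent; last first.
  move=> [u|[u h]] /=; have [m1 m2] := mC u; [exact: m1|exact: m2].
rewrite big_sumType /= big_split /=; congr (_ * _)%E.
by rewrite pair_bigA; apply: eq_bigr => -[u h].
Qed.

Lemma vertex_box_prob u c : measurable_box c ->
  P (vertex_box u c) =
  (P (weight G u @^-1` c.1) * \prod_h P (position G u h @^-1` c.2 h))%E.
Proof.
move=> mc; pose C u' := if u' == u then c else (setT, fun=> setT).
have mC u' : measurable_box (C u').
  by rewrite /C; case: ifP => // _; split => [|h]; exact: measurableT.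
rewrite (_ : vertex_box u c = \bigcap_u' vertex_box u' (C u')); last first.
  apply/seteqP; split => t /=.
    by move=> h u' _; rewrite /C; case: eqP => [->|].
  by move=> /(_ u I); rewrite /C eqxx.
rewrite box_prod// (bigD1 u)//= [X in (_ * X)%E]big1 => [|u' /negPf uu'].
  by rewrite mule1 /C eqxx.
rewrite /C uu' /= preimage_setT probability_setT mul1e; exact: big1.
Qed.

(** Boxes at distinct vertices are independent. *)
Lemma vertex_boxes_indep (C : 'I_n -> set R * ('I_d -> set R)) :
  (forall u, measurable_box (C u)) ->
  P (\bigcap_u vertex_box u (C u)) = (\prod_u P (vertex_box u (C u)))%E.
Proof.
move=> mC; rewrite box_prod//; apply: eq_bigr => u _.
by rewrite vertex_box_prob.
Qed.

Lemma vertex_box_sigma u c : measurable_box c ->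
  sigma_of (attribute G) (vertex_box u c).
Proof.
move=> mc.
rewrite (_ : vertex_box u c = weight G u @^-1` c.1 `&`
    \bigcap_h (position G u h @^-1` c.2 h)); last first.
  apply/seteqP; split => t /=; first by move=> [? h]; split => // i _; exact: h.
  by move=> [? h]; split => // i; exact: (h i I).
have sA s (A : set R) : measurable A ->
    (@measurable _ (g_sigma_algebraType [set C | exists s, exists2 A,
      measurable A & C = attribute G s @^-1` A])) (attribute G s @^-1` A).
  exact: attribute_preimage_sigma.
apply: (@measurableI _ (g_sigma_algebraType _)).
  by apply: (sA (inl u)); case: mc.
apply: (@measurable_fin_bigcap _ (g_sigma_algebraType _)) => h.
by apply: (sA (inr (u, h))); case: mc.
Qed.

Lemma weight_itvoc_prob u (lo hi : R) : w0 <= lo -> lo <= hi ->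
  P (weight G u @^-1` `]lo, hi]%classic) =
  ((w0 / lo) `^ (tau - 1) - (w0 / hi) `^ (tau - 1))%:E.
Proof.
move=> wlo lohi; rewrite ccdf_itvoc// !weight_pareto//.
exact: le_trans lohi.
Qed.

Lemma position_itvoc_prob u h (a b : R) : 0 <= a -> a <= b -> b <= 1 ->
  P (position G u h @^-1` `]a, b]%classic) = (b - a)%:E.
Proof.
move=> a0 ab b1; rewrite -(uniform_prob_itvoc a0 ab b1).
exact: (position_uniform G).
Qed.

End boxes.

(** * Two moment bounds for sums of indicators *)

Section indicator_sums.
Context {R : realType} {disp : measure_display} {T : measurableType disp}
  {P : probability T R}.

Lemma measurable_sum_indic (I : finType) (A : I -> set T) :
  (forall i, measurable (A i)) ->
  measurable_fun setT (fun t => \sum_i \1_(A i) t : R).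
Proof.
move=> mA; elim: (index_enum _) => [|i s IH].
  by under eq_fun do rewrite big_nil; exact: measurable_cst.
under eq_fun do rewrite big_cons.
by apply: measurable_funD => //; exact: measurable_indic.
Qed.

Lemma integral_sum_indic (I : finType) (A : I -> set T) :
  (forall i, measurable (A i)) ->
  (\int[P]_t (\sum_i \1_(A i) t)%:E = \sum_i P (A i))%E.
Proof.
move=> mA; under eq_integral do rewrite -sumEFin.
rewrite ge0_integral_sum//.
- by apply: eq_bigr => i _; rewrite integral_indic// setIT.
- by move=> i; apply/measurable_EFinP; exact: measurable_indic.
Qed.

(** An integrated form of the second moment method: the pointwise hypothesis is
    [bad t * m ^+ 2 <= 4 * (Z t - m) ^+ 2 + K * W t], where [Z] counts the
    events that occur and [W] the pairs of them related by [r]; both the variance of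
    [Z] and the mean of [W] are at most [O]. *)
Lemma integral_le_second_moment (I : finType) (A : I -> set T) (r : rel I)
    (p : I -> R) (p2 : I -> I -> R) (bad : T -> R) (m O K : R) :
  (forall i, measurable (A i)) -> (forall i, P (A i) = (p i)%:E) ->
  (forall i j, P (A i `&` A j) <= (p2 i j)%:E)%E ->
  \sum_i p i = m -> \sum_i \sum_j p2 i j <= m ^+ 2 + O ->
  \sum_i \sum_(j | r i j) p2 i j <= O ->
  0 <= K -> measurable_fun setT bad -> (forall t, 0 <= bad t) ->
  (forall t, bad t * m ^+ 2 <=
     4 * (\sum_i \1_(A i) t - m) ^+ 2 +
     K * \sum_i \sum_(j | r i j) \1_(A i `&` A j) t) ->
  ((m ^+ 2)%:E * \int[P]_t (bad t)%:E <= ((4 + K) * O)%:E)%E.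
Proof.
move=> mA pA p2A sp sp2 spr K0 mbad bad0 le.
have mAA (ij : I * I) : measurable (A ij.1 `&` A ij.2) by exact: measurableI.
pose A' (ij : I * I) := if r ij.1 ij.2 then A ij.1 `&` A ij.2 else set0.
have mA' ij : measurable (A' ij) by rewrite /A'; case: ifP.
have m0 : 0 <= m.
  by rewrite -sp; apply: sumr_ge0 => i _; rewrite -lee_fin -pA.
pose Z t : R := \sum_i \1_(A i) t.
pose Z2 t : R := \sum_(ij : I * I) \1_(A ij.1 `&` A ij.2) t.
pose W t : R := \sum_ij \1_(A' ij) t.
have Z2E t : Z2 t = Z t ^+ 2.
  rewrite /Z2 /Z expr2 mulr_suml -(pair_bigA _ (fun i j => \1_(A i `&` A j) t)) /=.
  apply: eq_bigr => i _; rewrite mulr_sumr; apply: eq_bigr => j _.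
  by rewrite !indicE in_setI -mulnb natrM.
have WE t : W t = \sum_i \sum_(j | r i j) \1_(A i `&` A j) t.
  rewrite /W pair_big_dep [RHS]big_mkcond /=; apply: eq_bigr => ij _.
  by rewrite /A'; case: ifP => //; rewrite indic0.
have Z0 t : 0 <= Z t by apply: sumr_ge0.
have Z20 t : 0 <= Z2 t by apply: sumr_ge0.
have W0 t : 0 <= W t by apply: sumr_ge0.
have mZ : measurable_fun setT Z by exact: measurable_sum_indic.
have mZ2 : measurable_fun setT Z2 by exact: measurable_sum_indic.
have mW : measurable_fun setT W by exact: measurable_sum_indic.
have IZ : (\int[P]_t (Z t)%:E = m%:E)%E.
  rewrite integral_sum_indic// -sp -sumEFin; exact: eq_bigr.
have IZ2 : (\int[P]_t (Z2 t)%:E <= (m ^+ 2 + O)%:E)%E.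
  rewrite integral_sum_indic//; apply: (@le_trans _ _ (\sum_i \sum_j p2 i j)%:E).
    rewrite pair_bigA /= -sumEFin.
    by apply: lee_sum => ij _; exact: p2A.
  by rewrite lee_fin.
have IW : (\int[P]_t (W t)%:E <= O%:E)%E.
  rewrite integral_sum_indic//.
  apply: (@le_trans _ _ (\sum_i \sum_(j | r i j) p2 i j)%:E).
    rewrite pair_big_dep /= -sumEFin [leRHS]big_mkcond /=.
    apply: lee_sum => ij _.
    by rewrite /A'; case: ifP => _; [exact: p2A|rewrite measure0].
  by rewrite lee_fin.
have mE (f : T -> R) : measurable_fun setT f ->
    measurable_fun setT (fun t => (f t)%:E) by move=> ?; exact/measurable_EFinP.
have mM (f : T -> R) (c : R) : measurable_fun setT f ->
    measurable_fun setT (fun t => c%:E * (f t)%:E)%E.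
  by move=> mf; apply: emeasurable_funM => //; exact: mE.
have intZ (c : R) (f : T -> R) : 0 <= c -> (forall t, 0 <= f t) ->
    measurable_fun setT f ->
    (\int[P]_t (c%:E * (f t)%:E) = c%:E * \int[P]_t (f t)%:E)%E.
  move=> c0 f0 mf; rewrite ge0_integralZl_EFin//; last exact: mE.
  by move=> t _; rewrite lee_fin.
have m20 : 0 <= m ^+ 2 by exact: sqr_ge0.
(* The negative term [- 8 * m * Z] of the expanded square is moved to the left,
   so that only nonnegative functions are integrated. *)
have : (\int[P]_t ((m ^+ 2)%:E * (bad t)%:E + (8 * m)%:E * (Z t)%:E) <=
    \int[P]_t (4%:E * (Z2 t)%:E + (K%:E * (W t)%:E + (4 * m ^+ 2)%:E)))%E.
  apply: ge0_le_integral => //.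
  - by move=> t _; rewrite -!EFinM -EFinD lee_fin addr_ge0// !mulr_ge0.
  - by apply: emeasurable_funD; exact: mM.
  - apply: emeasurable_funD; first exact: mM.
    by apply: emeasurable_funD => //; exact: mM.
  - move=> t _; rewrite -!EFinM -!EFinD lee_fin Z2E WE.
    by have := le t; rewrite -/(Z t); lra.
rewrite ge0_integralD//; first last.
- exact: mM.
- by move=> t _; rewrite -EFinM lee_fin !mulr_ge0.
- exact: mM.
- by move=> t _; rewrite -EFinM lee_fin !mulr_ge0.
rewrite !intZ ?mulr_ge0//.
rewrite IZ ge0_integralD//; first last.
- by apply: emeasurable_funD => //; exact: mM.
- move=> t _; rewrite -EFinM -EFinD lee_fin addr_ge0 ?mulr_ge0//.
- exact: mM.
- by move=> t _; rewrite -EFinM lee_fin mulr_ge0.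
rewrite ge0_integralD//; first last.
- by move=> t _; rewrite lee_fin mulr_ge0.
- exact: mM.
- by move=> t _; rewrite -EFinM lee_fin mulr_ge0.
rewrite !intZ//.
rewrite integral_cst//= probability_setT mule1 => H.
have H2 : (4%:E * \int[P]_t (Z2 t)%:E +
    (K%:E * \int[P]_t (W t)%:E + (4 * m ^+ 2)%:E)
   <= (4 * (m ^+ 2 + O) + (K * O + 4 * m ^+ 2))%:E)%E.
  rewrite !EFinD leeD//; first by rewrite EFinM lee_wpmul2l// lee_fin.
  by rewrite leeD// EFinM lee_wpmul2l// lee_fin.
have := le_trans H H2; rewrite -EFinM -leeBrDr// -EFinB => /le_trans; apply.
by rewrite lee_fin; lra.
Qed.

End indicator_sums.

Section pair_sums.
Context {R : realType} (K : finType) (M : nat) (J : finType).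
Variable rho : K -> R.
Hypothesis rho_ge0 : forall i, 0 <= rho i.

Notation index := ({ffun K -> 'I_M} * J)%type.

(** The two lists have a common entry at some place. *)
Definition overlap : rel index := fun u v => [exists i, u.1 i == v.1 i].

(** The probability that two lists both lie in their boxes, when [rho i] is the
    probability of a box at place [i]: lists without common entry are
    independent, and for lists with a common entry the boxes of different cells
    are disjoint. *)
Definition joint_bound (u v : index) : R :=
  if overlap u v then
    if u.2 == v.2 then
      \prod_i (if u.1 i == v.1 i then rho i else rho i ^+ 2)
    else 0
  else \prod_i rho i ^+ 2.

(** The expected number of lists lying in their boxes. *)
Definition mean_count : R := #|J|%:R * \prod_i (M%:R * rho i).

(** A bound for the expected number of pairs of overlapping lists that lie in
    their boxes: [a] is a place of coincidence. *)
Definition overlap_count : R :=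
  #|J|%:R * \sum_a (M%:R * rho a) *
    \prod_(i | i != a) (M%:R * rho i + (M%:R * rho i) ^+ 2).

Lemma sum_mean_count : \sum_(u : index) \prod_i rho i = mean_count.
Proof.
rewrite sumr_const card_prod card_ffun card_ord /mean_count -[LHS]mulr_natl.
rewrite big_split /= prodr_const natrM natrX cardE -cardE.
by rewrite mulrA; congr (_ * _); rewrite mulrC.
Qed.

Lemma sum_ffun_pair (g : K -> 'I_M -> 'I_M -> R) :
  \sum_(v : {ffun K -> 'I_M}) \sum_(v' : {ffun K -> 'I_M})
     \prod_i g i (v i) (v' i) = \prod_i \sum_x \sum_y g i x y.
Proof.
rewrite bigA_distr_bigA /=; apply: eq_bigr => v _.
by rewrite bigA_distr_bigA.
Qed.

Let M0 : 0 <= M%:R :> R. Proof. exact: ler0n. Qed.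

Lemma overlap_count_ge :
  \sum_u \sum_(v | overlap u v) joint_bound u v <= overlap_count.
Proof.
pose g (a i : K) (x y : 'I_M) : R :=
  if i == a then (x == y)%:R * rho i
  else (x == y)%:R * rho i + rho i ^+ 2.
have g0 a i x y : 0 <= g a i x y.
  by rewrite /g; case: ifP => _; rewrite ?addr_ge0 ?mulr_ge0 ?sqr_ge0.
have le1 u v : overlap u v ->
    joint_bound u v <= (u.2 == v.2)%:R * \sum_a \prod_i g a i (u.1 i) (v.1 i).
  move=> uv; rewrite /joint_bound uv; case: eqP => _; last by rewrite mul0r.
  rewrite mul1r; have /existsP[a uva] := uv.
  rewrite [leRHS](bigD1 a)//= -[leLHS]addr0 lerD//; last first.
    by apply: sumr_ge0 => a' _; apply: prodr_ge0.
  apply: ler_prod => i _; rewrite /g.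
  case: (eqVneq i a) => [->|_]; first by rewrite uva mul1r rho_ge0 lexx.
  case: ifP => _; rewrite ?mul1r ?mul0r ?add0r ?rho_ge0 ?sqr_ge0 ?lexx//.
  by rewrite lerDl sqr_ge0.
apply: (@le_trans _ _ (\sum_(u : index) \sum_(v : index)
    (u.2 == v.2)%:R * \sum_a \prod_i g a i (u.1 i) (v.1 i))).
  apply: ler_sum => u _; rewrite big_mkcond; apply: ler_sum => v _.
  case: ifP => [/le1//|_]; rewrite mulr_ge0//.
  by apply: sumr_ge0 => a _; apply: prodr_ge0.
rewrite (_ : \sum_u _ = #|J|%:R * \sum_a \prod_i \sum_x \sum_y g a i x y).
  rewrite /overlap_count ler_wpM2l// ler_sum// => a _.
  have sx (i : K) : \sum_(x < M) \sum_(y < M) (x == y)%:R * rho i = M%:R * rho i.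
    rewrite -[X in _ = X%:R * _](card_ord M) mulr_natl -sumr_const.
    apply: eq_bigr => x _; rewrite (bigD1 x)//= eqxx mul1r big1 ?addr0// => y.
    by rewrite eq_sym => /negPf ->; rewrite mul0r.
  rewrite (bigD1 a)//= {1}/g eqxx sx ler_wpM2l ?mulr_ge0//.
  apply: ler_prod => i /negPf ia; rewrite /g ia.
  under eq_bigr do rewrite big_split /=.
  rewrite big_split /= sx !sumr_const !card_ord.
  have -> : rho i ^+ 2 *+ M *+ M = (M%:R * rho i) ^+ 2.
    by rewrite -mulrnA -[LHS]mulr_natl natrM exprMn expr2.
  by rewrite lexx addr_ge0 ?mulr_ge0 ?sqr_ge0.
transitivity (\sum_(v : {ffun K -> 'I_M}) \sum_(j : J)
   \sum_(v' : {ffun K -> 'I_M}) \sum_(j' : J) (j == j')%:R *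
   \sum_a \prod_i g a i (v i) (v' i)).
  rewrite [RHS]pair_bigA /=; apply: eq_bigr => u _.
  by rewrite [RHS]pair_bigA.
transitivity (\sum_(v : {ffun K -> 'I_M}) \sum_(j : J)
   \sum_(v' : {ffun K -> 'I_M}) \sum_a \prod_i g a i (v i) (v' i)).
  apply: eq_bigr => v _; apply: eq_bigr => j _; apply: eq_bigr => v' _.
  rewrite (bigD1 j)//= eqxx mul1r [X in _ + X]big1 ?addr0// => j'.
  by rewrite eq_sym => /negPf ->; rewrite mul0r.
under eq_bigr do rewrite sumr_const -[_ *+ #|J|]mulr_natl.
rewrite -mulr_sumr; congr (_ * _).
under eq_bigr do rewrite exchange_big /=.
rewrite exchange_big; apply: eq_bigr => a _; exact: sum_ffun_pair.
Qed.

Lemma joint_bound_sum_le :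
  \sum_u \sum_v joint_bound u v <= mean_count ^+ 2 + overlap_count.
Proof.
under eq_bigr => u _ do rewrite (bigID (overlap u)) /=.
rewrite big_split /= addrC lerD//; last exact: overlap_count_ge.
rewrite -sum_mean_count expr2 mulr_suml; apply: ler_sum => u _.
rewrite mulr_sumr big_mkcond; apply: ler_sum => v _.
rewrite /joint_bound; case: ifP => /= [/negPf ->|_].
  by rewrite -big_split.
by apply: mulr_ge0; exact: prodr_ge0.
Qed.

(** When the numbers [M%:R * rho i] are bounded below, the overlapping pairs are
    negligible as soon as [#|J|%:R * (M%:R * rho i)] is large for every [i]. *)
Lemma overlap_count_le (c1 D : R) : 0 < c1 -> 0 < D -> 
  (forall i, c1 <= M%:R * rho i) -> (forall i, D <= #|J|%:R * (M%:R * rho i)) ->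
  overlap_count <= mean_count ^+ 2 * (#|K|%:R * (1 + c1^-1) ^+ #|K| / D).
Proof.
move=> c0 D0 c1le Dle.
pose x i := M%:R * rho i.
have x0 i : 0 < x i by exact: lt_le_trans (c1le i).
rewrite /overlap_count /mean_count exprMn -prodrXl.
rewrite mulr_sumr (_ : _ * (_ / D) = \sum_(a : K) #|J|%:R ^+ 2 *
    \prod_i x i ^+ 2 * ((1 + c1^-1) ^+ #|K| / D)); last first.
  by rewrite sumr_const -[_ *+ #|K|]mulr_natl /x; ring.
apply: ler_sum => a _; rewrite [in leRHS](bigD1 a)//= -/(x a).
have -> : \prod_(i | i != a) (x i + x i ^+ 2) =
    \prod_(i | i != a) x i ^+ 2 * \prod_(i | i != a) ((x i)^-1 + 1).
  rewrite -big_split; apply: eq_bigr => i _ /=.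
  by field; rewrite gt_eqF.
have p2 : 0 <= \prod_(i | i != a) x i ^+ 2.
  by apply: prodr_ge0 => *; exact: sqr_ge0.
have ple : \prod_(i | i != a) ((x i)^-1 + 1) <= (1 + c1^-1) ^+ #|K|.
  apply: (@le_trans _ _ (\prod_(i | i != a) (1 + c1^-1))).
    apply: ler_prod => i _; rewrite addrC lerD2l lef_pV2 ?posrE ?c1le ?andbT//.
    by rewrite addr_ge0// invr_ge0 ltW.
  rewrite prodr_const; apply: ler_weXn2l; last exact: max_card.
  by rewrite lerDl invr_ge0 ltW.
have Dx : 1 <= #|J|%:R * x a / D by rewrite ler_pdivlMr// mul1r; exact: Dle.
set p := \prod_(i | i != a) x i ^+ 2 in p2 *.
set q := \prod_(i | i != a) _ in ple *.
set C := (_ ^+ #|K|) in ple *.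
have C0 : 0 <= C by rewrite exprn_ge0// addr_ge0// invr_ge0 ltW.
have -> : #|J|%:R ^+ 2 * (x a ^+ 2 * p) * (C / D) =
  (#|J|%:R * x a * p * C) * (#|J|%:R * x a / D) by ring.
have h : #|J|%:R * (x a * (p * q)) <= #|J|%:R * x a * p * C.
  by rewrite !mulrA ler_wpM2l// !mulr_ge0// ltW.
apply: le_trans h _; rewrite ler_peMr// !mulr_ge0// ltW//.
Qed.

End pair_sums.

(** * Lists of vertices lying in prescribed boxes *)

Section slots.
Variables (m n : nat).
Let M := (n %/ m.+1)%N.

Fact slot_subproof (i : 'I_m.+1) (a : 'I_M) : (i * M + a < n)%N.
Proof.
apply: (@leq_trans (i.+1 * M)%N); first by rewrite mulSn addnC ltn_add2r.
by apply: leq_trans (leq_trunc_div n m.+1); rewrite mulnC leq_mul2l ltn_ord orbT.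
Qed.

(** The vertices are cut into consecutive classes of equal size, one for each
    place in a list, so that a list with one vertex in each class is increasing
    and can be recovered from its set of entries. *)
Definition slot (i : 'I_m.+1) (a : 'I_M) : 'I_n := Ordinal (slot_subproof i a).

Lemma slot_lt (i : 'I_m.+1) a (i' : 'I_m.+1) a' :
  (i < i')%N -> (slot i a < slot i' a')%N.
Proof.
move=> ii' /=; apply: (@leq_trans (i.+1 * M)%N).
  by rewrite mulSn addnC ltn_add2r.
by apply: leq_trans (leq_addr _ _); rewrite leq_mul2r ii' orbT.
Qed.

Lemma slot_inj i a i' a' : slot i a = slot i' a' -> i = i' /\ a = a'.
Proof.
have [ii'|ii'|/val_inj ->] := ltngtP i i'.
- by move=> eq_s; have := slot_lt a a' ii'; rewrite eq_s ltnn.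
- by move=> eq_s; have := slot_lt a' a ii'; rewrite eq_s ltnn.
by move=> /(congr1 val) /= /addnI/val_inj.
Qed.

(** The list with entry [slot i (v i)] at place [i]. *)
Definition slot_list (v : {ffun 'I_m.+1 -> 'I_M}) : {ffun 'I_m.+1 -> 'I_n} :=
  [ffun i => slot i (v i)].

(** The pairs of entries of [slot_list v], in increasing order. *)
Definition slot_edges (v : {ffun 'I_m.+1 -> 'I_M}) : {set 'I_n * 'I_n} :=
  [set (slot p.1 (v p.1), slot p.2 (v p.2)) |
    p in [pred p : 'I_m.+1 * 'I_m.+1 | (p.1 < p.2)%N]].

Lemma slot_edges_disjoint v v' :
  ~~ [disjoint slot_edges v & slot_edges v'] -> [exists i, v i == v' i].
Proof.
rewrite -setI_eq0 => /set0Pn[e]; rewrite inE => /andP[/imsetP[p _ ->]].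
move=> /imsetP[p' _ /(congr1 fst)/slot_inj[p1 v1]].
by apply/existsP; exists p.1; rewrite v1 p1.
Qed.

Lemma prod_slot_edges {R : realType} v (f : 'I_n * 'I_n -> R) :
  \prod_(e in slot_edges v) f e =
  \prod_(i < m.+1) \prod_(j < m.+1 | (i < j)%N) f (slot i (v i), slot j (v j)).
Proof.
rewrite big_imset /=; last first.
  move=> [a b] [a' b'] _ _ /= eq_ab.
  have [-> _] := slot_inj (congr1 fst eq_ab).
  by have [-> _] := slot_inj (congr1 snd eq_ab).
by rewrite pair_big_dep /=; apply: eq_bigl => p; rewrite inE.
Qed.

Lemma slot_list_set_inj v v' :
  [set slot_list v i | i : 'I_m.+1] = [set slot_list v' i | i : 'I_m.+1] ->
  v = v'.
Proof.
move=> /setP eqS; apply/ffunP => i.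
have := eqS (slot_list v i); rewrite imset_f// => /esym/imsetP[i' _].
by rewrite !ffunE => /slot_inj[<-].
Qed.

End slots.

Section box_algebra.
Context {R : realType} {tau w0 gamma : R} {d n : nat} {disp : measure_display}
  {T : measurableType disp} {P : probability T R}.
Variable G : girg tau w0 gamma d n P.

(** No constraint. *)
Definition full_box : set R * ('I_d -> set R) := (setT, fun=> setT).

(** The conjunction of two constraints. *)
Definition meet_box (c c' : set R * ('I_d -> set R)) : set R * ('I_d -> set R) :=
  (c.1 `&` c'.1, fun h => c.2 h `&` c'.2 h).

Lemma measurable_full_box : measurable_box full_box.
Proof. by split => [|h]; exact: measurableT. Qed.

Lemma measurable_meet_box c c' :
  measurable_box c -> measurable_box c' -> measurable_box (meet_box c c').
Proof. by move=> [m1 m2] [m1' m2']; split => [|h]; exact: measurableI. Qed.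

Lemma vertex_box_full u : vertex_box G u full_box = setT.
Proof. by apply/seteqP; split. Qed.

Lemma vertex_box_meet u c c' :
  vertex_box G u (meet_box c c') = vertex_box G u c `&` vertex_box G u c'.
Proof.
apply/seteqP; split => t /=.
  by move=> [[h1 h1'] h]; split; split => // i; have [] := h i.
by move=> [[h1 h] [h1' h']]; split.
Qed.

Lemma vertex_boxes_indep_inj (X : finType) (f : X -> 'I_n)
    (C : X -> set R * ('I_d -> set R)) :
  injective f -> (forall x, measurable_box (C x)) ->
  P (\bigcap_x vertex_box G (f x) (C x)) =
  (\prod_x P (vertex_box G (f x) (C x)))%E.
Proof.
move=> f_inj mC.
pose D u := if [pick x | f x == u] is Some x then C x else full_box.
have DE x : D (f x) = C x.
  rewrite /D; case: pickP => [y /eqP /f_inj ->//|/(_ x)].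
  by rewrite eqxx.
have mD u : measurable_box (D u).
  by rewrite /D; case: pickP => // _; exact: measurable_full_box.
have D_full u : u \notin codom f -> D u = full_box.
  rewrite /D; case: pickP => // x /eqP <-.
  by rewrite codom_f.
rewrite (_ : \bigcap_x _ = \bigcap_u vertex_box G u (D u)); last first.
  apply/seteqP; split => t h.
    move=> u _; have [/codomP[x ->]|/D_full ->] := boolP (u \in codom f).
      by rewrite DE; exact: (h x I).
    by rewrite vertex_box_full.
  by move=> x _; rewrite -DE; exact: (h (f x) I).
rewrite vertex_boxes_indep// (bigID (mem (codom f))) /=.
rewrite [X in (_ * X)%E]big1 ?mule1; last first.
  by move=> u /D_full ->; rewrite vertex_box_full probability_setT.
rewrite (eq_bigl [in f @: predT]) => [|u]; last first.
  by apply/codomP/imsetP => [[x ->]|[x _ ->]]; exists x.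
rewrite big_imset /=; last by move=> x y _ _; exact: f_inj.
by apply: eq_big => x; rewrite ?inE// DE.
Qed.

End box_algebra.

Section counting.
Context {R : realType} {tau w0 gamma : R} {d n : nat} {disp : measure_display}
  {T : measurableType disp} {P : probability T R}.
Variable G : girg tau w0 gamma d n P.

Variables (m : nat) (J : finType).
Let M := (n %/ m.+1)%N.
Notation index := ({ffun 'I_m.+1 -> 'I_M} * J)%type.

Variables (Q : J -> 'I_m.+1 -> set R * ('I_d -> set R)) (rho : 'I_m.+1 -> R).
Hypotheses (mQ : forall j i, measurable_box (Q j i))
  (prQ : forall j i u, P (vertex_box G u (Q j i)) = (rho i)%:E).

(** Every vertex of the list [u.1] lies in the box that the cell [u.2]
    prescribes for its place in the list. *)
Definition list_event (u : index) : set T :=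
  \bigcap_i vertex_box G (slot_list u.1 i) (Q u.2 i).

Lemma list_event_sigma u : sigma_of (attribute G) (list_event u).
Proof.
apply: (@measurable_fin_bigcap _ (g_sigma_algebraType _)) => i.
exact: vertex_box_sigma.
Qed.

Lemma list_event_measurable u : measurable (list_event u).
Proof. by apply: sigma_of_measurable; exact: list_event_sigma. Qed.

Lemma list_event_prob u : P (list_event u) = (\prod_i rho i)%:E.
Proof.
rewrite /list_event vertex_boxes_indep_inj//.
  by rewrite -prodEFin; apply: eq_bigr => i _.
by move=> i i'; rewrite !ffunE => /slot_inj[].
Qed.

Lemma list_event_joint (u v : index) :
  (forall i, u.1 i = v.1 i -> u.2 = v.2) ->
  P (list_event u `&` list_event v) =
  (\prod_i (if u.1 i == v.1 i then rho i else rho i ^+ 2))%:E.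
Proof.
move=> uv.
pose C (x : 'I_m.+1 * 'I_M) := meet_box
  (if x.2 == u.1 x.1 then Q u.2 x.1 else full_box)
  (if x.2 == v.1 x.1 then Q v.2 x.1 else full_box).
have mC x : measurable_box (C x).
  by apply: measurable_meet_box; case: ifP => // _; exact: measurable_full_box.
rewrite (_ : _ `&` _ = \bigcap_x vertex_box G (slot x.1 x.2) (C x)); last first.
  apply/seteqP; split => t /=.
    move=> [hu hv] [i a] _ /=; rewrite vertex_box_meet /=; split; case: eqP => //.
    - by move=> ->; have := hu i I; rewrite ffunE.
    - by move=> ->; have := hv i I; rewrite ffunE.
  move=> h; split => i _; rewrite ffunE.
    by have := h (i, u.1 i) I; rewrite vertex_box_meet /= eqxx => -[].
  by have := h (i, v.1 i) I; rewrite vertex_box_meet /= eqxx => -[].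
rewrite vertex_boxes_indep_inj//; last first.
  by move=> [i a] [i' a'] /= /slot_inj[-> ->].
rewrite -(pair_bigA _ (fun i a => P (vertex_box G (slot i a) (C (i, a))))) /=.
rewrite -prodEFin; apply: eq_bigr => i _.
have offC a : a != u.1 i -> a != v.1 i ->
    P (vertex_box G (slot i a) (C (i, a))) = 1%E.
  move=> /negPf au /negPf av.
  by rewrite vertex_box_meet /= au av !vertex_box_full setTI probability_setT.
case: eqP => [eq_uv|/eqP ne_uv].
  rewrite (bigD1 (u.1 i))//= [X in (_ * X)%E]big1 ?mule1; last first.
    by move=> a au; apply: offC => //; rewrite -eq_uv.
  by rewrite vertex_box_meet /= -eq_uv eqxx -(uv _ eq_uv) setIid prQ.
rewrite (bigD1 (u.1 i))//= (bigD1 (v.1 i)) /=; last by rewrite eq_sym.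
rewrite [X in (_ * (_ * X))%E]big1 ?mule1; last first.
  by move=> a /andP[au av]; apply: offC.
rewrite !vertex_box_meet /= !eqxx (negPf ne_uv).
rewrite [v.1 i == _]eq_sym (negPf ne_uv).
by rewrite !vertex_box_full setTI setIT !prQ expr2 EFinM.
Qed.

(** Boxes of distinct cells never meet at any given place in the list. *)
Hypothesis disjQ : forall i w t j j', vertex_box G w (Q j i) t ->
  vertex_box G w (Q j' i) t -> j = j'.

Lemma list_event_joint_le (u v : index) :
  (P (list_event u `&` list_event v) <= (joint_bound rho u v)%:E)%E.
Proof.
rewrite /joint_bound; case: ifP => [/existsP[i /eqP uvi]|/negbT]; last first.
  rewrite negb_exists => /forallP uv.
  rewrite list_event_joint; last first.
    by move=> i /eqP uvi; have := uv i; rewrite uvi.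
  rewrite lee_fin le_eqVlt; apply/orP; left; apply/eqP.
  by apply: eq_bigr => i _; rewrite (negPf (uv i)).
case: eqP => [uv|uv]; first by rewrite list_event_joint.
rewrite (_ : _ `&` _ = set0) ?measure0//.
apply/seteqP; split => // t [/= hu hv]; apply: uv.
have := hu i I; have := hv i I; rewrite !ffunE uvi.
by move=> h h'; exact: disjQ h' h.
Qed.

End counting.

Section clique_bounds.
Context {R : realType} {tau w0 gamma : R} {d n : nat} {disp : measure_display}
  {T : measurableType disp} {P : probability T R}.
Variable G : girg tau w0 gamma d n P.
Hypothesis mean_ge0 : 0 <= mean_weight tau w0.
Variables (m : nat) (eps : R) (alpha : 'I_m.+1 -> R) (beta : 'I_m -> 'I_d -> R).

Lemma measurable_config_mix (B : {ffun 'I_n * 'I_n -> bool} -> set T) :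
  (forall e, measurable (B e)) -> measurable_fun setT
    (fun t => \sum_e bernoulli_weight (config_prob G t) e * \1_(B e) t : R).
Proof.
move=> mB; elim: (index_enum _) => [|e s IH].
  by under eq_fun do rewrite big_nil; exact: measurable_cst.
under eq_fun do rewrite big_cons.
apply: measurable_funD => //; apply: measurable_funM.
  exact: measurable_bernoulli_weight.
exact: measurable_indic.
Qed.

Lemma measurable_all_true F : measurable [set t | all_true (edge_config G t) F].
Proof.
rewrite (_ : [set t | _] = \bigcup_(e in [set e | all_true e F])
    [set t | edge_config G t = e]).
  by apply: measurable_fin_bigcup => e _; exact: measurable_edge_config.
by apply/seteqP; split => t /=; [exists (edge_config G t)|move=> [e ? ->]].
Qed.

Lemma measurable_weight u : measurable_fun setT (weight G u : T -> R).
Proof. exact: measurable_funPT. Qed.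

Lemma measurable_position u h : measurable_fun setT (position G u h : T -> R).
Proof. exact: measurable_funPT. Qed.

Lemma measurable_in_M v : measurable [set t | in_M G eps alpha beta t v].
Proof.
apply: measurable_andb; first exact: measurable_cstb.
apply: measurable_andb.
  apply: measurable_forallb => i; apply: measurable_mem_itv.
  exact: measurable_weight.
apply: measurable_forallb => i; apply: measurable_forallb => h.
apply: measurable_mem_itv; apply: measurable_circle_dist;
  exact: measurable_position.
Qed.

Let counted t (K : {set 'I_n}) :=
  [&& #|K| == m.+1, is_clique G t K &
    [exists v : {ffun 'I_m.+1 -> 'I_n},
      in_M G eps alpha beta t v && (K == [set v i | i : 'I_m.+1])]].

Let measurable_counted K : measurable [set t | counted t K].
Proof.
apply: measurable_andb; first exact: measurable_cstb.
apply: measurable_andb.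
  apply: measurable_forallb => u; apply: measurable_implyb.
  apply: measurable_forallb => v; apply: measurable_implyb.
  by apply: measurable_implyb; exact: adj_measurable.
apply: measurable_existsb => v.
by apply: measurable_andb; [exact: measurable_in_M | exact: measurable_cstb].
Qed.

Let clique_countE t :
  (clique_count G eps alpha beta t)%:R = \sum_K \1_[set t | counted t K] t :> R.
Proof.
rewrite /clique_count -sum1_card natr_sum big_mkcond.
apply: eq_bigr => K _; rewrite indicE.
rewrite (_ : (K \in in_set _) = counted t K); last exact: asboolb.
rewrite (_ : (t \in _) = counted t K); last exact: asboolb.
by case: counted.
Qed.

Lemma measurable_clique_count :
  measurable_fun setT (fun t => (clique_count G eps alpha beta t)%:R : R).
Proof. by under eq_fun do rewrite clique_countE; exact: measurable_sum_indic. Qed.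

Lemma measurable_clique_count_le x :
  measurable [set t | (clique_count G eps alpha beta t)%:R <= x :> R].
Proof.
rewrite (_ : [set t | _] =
  [set t | (clique_count G eps alpha beta t)%:R \in `]-oo, x] ]); last first.
  by apply/seteqP; split => t /=; rewrite in_itv.
exact: measurable_mem_itv measurable_clique_count.
Qed.

Variable J : finType.
Let M := (n %/ m.+1)%N.
Notation index := ({ffun 'I_m.+1 -> 'I_M} * J)%type.
Variables (Q : J -> 'I_m.+1 -> set R * ('I_d -> set R)) (rho : 'I_m.+1 -> R).
Hypotheses (mQ : forall j i, measurable_box (Q j i))
  (prQ : forall j i u, P (vertex_box G u (Q j i)) = (rho i)%:E).
Notation event u := (list_event G Q u).

Hypothesis in_M_event : forall (u : index) t,
  event u t -> in_M G eps alpha beta t (slot_list u.1).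
Hypothesis event_cell : forall (v : {ffun 'I_m.+1 -> 'I_M}) (j j' : J) t,
  event (v, j) t -> event (v, j') t -> j = j'.

(** The number of lists, one vertex in each class, that lie in their boxes and
    whose entries are pairwise adjacent. *)
Definition list_count (e : {ffun 'I_n * 'I_n -> bool}) (t : T) : R :=
  \sum_(u in [pred u : index | `[< event u t >] ])
    (all_true e (slot_edges u.1))%:R.

Lemma list_count_le t : list_count (edge_config G t) t <=
  (clique_count G eps alpha beta t)%:R.
Proof.
rewrite /list_count -natr_sum -big_mkcondr sum1_card ler_nat.
pose S : {set index} := finset (fun u => `[< event u t >] &&
  all_true (edge_config G t) (slot_edges u.1)).
pose f (u : index) := [set slot_list u.1 i | i : 'I_m.+1].
apply: (@leq_trans #|S|).
  by rewrite subset_leq_card//; apply/fintype.subsetP => u; rewrite !inE.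
have f_inj : {in S &, injective f}.
  move=> [v j] [v' j']; rewrite !inE /= => /andP[/asboolP h _] /andP[/asboolP h' _].
  move=> /slot_list_set_inj /= vv'; rewrite vv' in h *.
  by congr (_, _); exact: event_cell h h'.
rewrite -(card_in_imset f_inj) subset_leq_card//; apply/fintype.subsetP => K.
move=> /imsetP[u]; rewrite inE => /andP[/asboolP hu /forall_inP ue] ->.
have s_inj : injective (slot_list u.1).
  by move=> i i'; rewrite !ffunE => /slot_inj[].
apply/asboolP; apply/and3P; split.
- by rewrite card_imset// card_ord.
- apply/forall_inP => _ /imsetP[i _ ->]; apply/forall_inP => _ /imsetP[i' _ ->].
  apply/implyP => ne; rewrite !ffunE.
  have adj_lt (a b : 'I_m.+1) : (a < b)%N ->
      adj G t (slot a (u.1 a)) (slot b (u.1 b)).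
    move=> ab.
    have := ue (slot a (u.1 a), slot b (u.1 b)); rewrite ffunE /=.
    rewrite slot_lt// andTb; apply.
    by apply/imsetP; exists (a, b).
  have [ii'|ii'|/val_inj ii'] := ltngtP i i'; first exact: adj_lt.
    by rewrite adj_sym; exact: adj_lt.
  by rewrite ii' eqxx in ne.
- by apply/existsP; exists (slot_list u.1); rewrite in_M_event//= eqxx.
Qed.

Variable q : R.
Hypotheses (q_ge0 : 0 <= q) (edge_event : forall (u : index) t, event u t ->
  q <= \prod_(i < m.+1) \prod_(j < m.+1 | (i < j)%N)
         edge_prob G (slot i (u.1 i)) (slot j (u.1 j)) t).

Let edge_event' u t : event u t ->
  q <= \prod_(p in slot_edges u.1) config_prob G t p.
Proof.
move=> ut; rewrite prod_slot_edges; apply: le_trans (edge_event ut) _.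
rewrite le_eqVlt; apply/orP; left; apply/eqP.
apply: eq_bigr => i _; apply: eq_bigr => j ij.
by rewrite /config_prob /= (slot_lt (u.1 i) (u.1 j) ij).
Qed.

Let event_edges_prob u :
  ((q * \prod_i rho i)%:E <=
   P [set t | event u t /\ all_true (edge_config G t) (slot_edges u.1)])%E.
Proof.
pose B e : set T := if all_true e (slot_edges u.1) then event u else set0.
have sB e : sigma_of (attribute G) (B e).
  rewrite /B; case: ifP => _; first exact: list_event_sigma.
  exact: (@measurable0 _ (g_sigma_algebraType _)).
rewrite (_ : [set t | _] = [set t | B (edge_config G t) t]); last first.
  by apply/seteqP; split => t /=; rewrite /B;
    [move=> [h ->]|case: ifP => // ?; split].
rewrite disintegration// EFinM -(list_event_prob mQ prQ u).
rewrite -[event u]setIT -integral_indic//; last exact: list_event_measurable.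
rewrite -ge0_integralZl_EFin//; last first.
  by apply/measurable_EFinP/measurable_indic; exact: list_event_measurable.
apply: ge0_le_integral => //.
- by move=> t _; rewrite -EFinM lee_fin mulr_ge0.
- apply: emeasurable_funM => //.
  by apply/measurable_EFinP/measurable_indic; exact: list_event_measurable.
- apply/measurable_EFinP/measurable_config_mix => e.
  exact: sigma_of_measurable.
- move=> t _; rewrite -EFinM lee_fin.
  have -> : \sum_e bernoulli_weight (config_prob G t) e * \1_(B e) t =
      \1_(event u) t * \prod_(p in slot_edges u.1) config_prob G t p.
    rewrite -sum_bernoulli_weight_all_true mulr_sumr; apply: eq_bigr => e _.
    rewrite /B; case: (all_true e _); rewrite ?indic0 ?mulr1 ?mulr0//.
    by rewrite mulrC.
  rewrite mulrC indicE; case: (boolP (t \in event u)) => [|_].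
    by rewrite inE => /edge_event'; rewrite !mul1r.
  by rewrite !mul0r.
Qed.

Local Notation mean := (mean_count M J rho).

(** On the event of each list, the edges are all present with conditional
    probability at least [q]. *)
Lemma expected_clique_count_ge :
  ((q * mean)%:E <=
   'E_P[fun t => (clique_count G eps alpha beta t)%:R])%E.
Proof.
pose S (u : index) := [set t | event u t /\
  all_true (edge_config G t) (slot_edges u.1)].
have mS u : measurable (S u).
  apply: measurableI; first exact: list_event_measurable.
  exact: measurable_all_true.
apply: (@le_trans _ _ (\sum_u P (S u))%E).
  rewrite -sum_mean_count mulr_sumr -sumEFin; apply: lee_sum => u _.
  exact: event_edges_prob.
rewrite -integral_sum_indic// expectation.unlock; apply: ge0_le_integral => //.
- by move=> t _; rewrite lee_fin; apply: sumr_ge0.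
- by apply/measurable_EFinP; exact: measurable_sum_indic.
- by apply/measurable_EFinP; exact: measurable_clique_count.
- move=> t _; rewrite lee_fin; apply: le_trans (list_count_le t).
  rewrite /list_count [leRHS]big_mkcond; apply: ler_sum => u _.
  rewrite indicE inE; case: asboolP => h.
    have [[h1 h2]|nS] := pselect (S u t); first by rewrite mem_set// h2.
    by rewrite memNset//.
  by rewrite memNset//; move=> [].
Qed.

Hypothesis q_gt0 : 0 < q.
Hypothesis rho_ge0 : forall i, 0 <= rho i.
Hypothesis disjQ : forall i w t j j', vertex_box G w (Q j i) t ->
  vertex_box G w (Q j' i) t -> j = j'.

(** The pointwise hypothesis of [integral_le_second_moment] holds with
    [K = 16 / q ^+ 2]: where the number of lists in their boxes is less than
    half its mean, the square of the deviation dominates; elsewhere Chebyshev's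
    inequality for the edges applies. *)
Lemma clique_count_le_prob :
  ((mean ^+ 2)%:E *
   P [set t | ((clique_count G eps alpha beta t)%:R <= q * mean / 4 :> R)%R] <=
   ((4 + 16 / q ^+ 2) * overlap_count M J rho)%:E)%E.
Proof.
pose B e : set T := [set t | (list_count e t <= q * mean / 4)%R].
have sB e : sigma_of (attribute G) (B e).
  pose Phi (f : {ffun index -> bool}) : bool :=
    \sum_(u in [pred u | f u]) (all_true e (slot_edges u.1))%:R <= q * mean / 4.
  rewrite (_ : B e = [set t | Phi [ffun u => `[< event u t >] ] ]); last first.
    have PhiE t : Phi [ffun u => `[< event u t >] ] =
        (list_count e t <= q * mean / 4).
      by congr (_ <= _); apply: eq_bigl => u; rewrite !inE ffunE.
    by apply/seteqP; split => t /=; rewrite PhiE.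
  apply: (@measurable_finite_pattern _ (g_sigma_algebraType _)) => u.
  rewrite (_ : [set t | _] = event u); first exact: list_event_sigma.
  by apply/seteqP; split => t /asboolP.
have mB e := sigma_of_measurable (sB e).
pose bad t := \sum_e bernoulli_weight (config_prob G t) e * \1_(B e) t.
have wt0 t e := bernoulli_weight_ge0 (config_prob01 G t) e.
apply: (@le_trans _ _ ((mean ^+ 2)%:E * \int[P]_t (bad t)%:E)%E).
  apply: lee_wpmul2l; first by rewrite lee_fin sqr_ge0.
  rewrite -disintegration//; apply: le_measure; rewrite ?inE.
  - exact: measurable_clique_count_le.
  - rewrite (_ : [set t | _] = \bigcup_e (B e `&` [set t | edge_config G t = e])).
      apply: measurable_fin_bigcup => e _; apply: measurableI => //.
      exact: measurable_edge_config.
    apply/seteqP; split => t /=; first by exists (edge_config G t).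
    by move=> [e _ [/= Be eE]]; rewrite eE.
  - by move=> t /= le; rewrite /B /=; apply: le_trans (list_count_le t) le.
have K0 : 0 <= 16 / q ^+ 2 by rewrite divr_ge0// sqr_ge0.
have mean_ge0' : 0 <= mean.
  by rewrite mulr_ge0//; apply: prodr_ge0 => i _; rewrite mulr_ge0.
apply: (@integral_le_second_moment _ _ _ _ _ (list_event G Q) (@overlap 'I_m.+1 M J)
  (fun=> \prod_i rho i) (joint_bound rho)) => //.
- by move=> u; exact: list_event_measurable.
- by move=> u; exact: list_event_prob.
- by move=> u v; exact: list_event_joint_le.
- exact: sum_mean_count.
- exact: joint_bound_sum_le.
- exact: overlap_count_ge.
- exact: measurable_config_mix.
- by move=> t; apply: sumr_ge0 => e _; rewrite mulr_ge0.
move=> t; pose c := [pred u : index | `[< event u t >] ].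
have ZE : \sum_u \1_(event u) t = #|c|%:R :> R.
  rewrite -sum1_card natr_sum [RHS]big_mkcond; apply: eq_bigr => u _.
  by rewrite indicE inE; case: asboolP => h; [rewrite mem_set|rewrite memNset].
have badE : bad t = \sum_(e | list_count e t <= q * mean / 4)
    bernoulli_weight (config_prob G t) e.
  rewrite [RHS]big_mkcond; apply: eq_bigr => e _; rewrite indicE.
  by case: ifP => le; [rewrite mem_set ?mulr1|rewrite memNset ?mulr0// /B /= le].
have bad1 : bad t <= 1.
  rewrite -(sum_bernoulli_weight (config_prob G t)); apply: ler_sum => e _.
  by rewrite indicE ler_piMr// lern1 leq_b1.
rewrite ZE.
set W := \sum_u _.
have W0 : 0 <= W by apply: sumr_ge0 => u _; apply: sumr_ge0.
have [small|large] := ltP (#|c|%:R * 2) mean.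
  apply: (@le_trans _ _ (4 * (#|c|%:R - mean) ^+ 2)).
    apply: (@le_trans _ _ (mean ^+ 2)); first by rewrite ler_piMl// sqr_ge0.
    have c0 : 0 <= #|c|%:R :> R by exact: ler0n.
    by nra.
  by rewrite lerDl mulr_ge0.
have [->|mean_gt0] := eqVneq mean 0.
  rewrite expr0n mulr0; apply: addr_ge0; last exact: mulr_ge0.
  by rewrite mulr_ge0// sqr_ge0.
have {mean_gt0} mean_gt0 : 0 < mean by rewrite lt_def mean_gt0.
have cheb := @bernoulli_chebyshev _ _ _ (config_prob01 G t) _
  (fun u : index => slot_edges u.1) c q (q * mean / 4).
have {cheb} : bad t * (q * #|c|%:R - q * mean / 4) ^+ 2 <= W.
  rewrite badE; apply: le_trans (cheb _ _) _.
  - by move=> u /asboolP; exact: edge_event'.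
  - by rewrite -mulrA ltr_pM2l//; lra.
  rewrite /W big_mkcond; apply: ler_sum => u _.
  case: ifP => [/asboolP cu|_]; last by apply: sumr_ge0.
  rewrite big_mkcond [leRHS]big_mkcond; apply: ler_sum => v _.
  case: ifP => [/asboolP cv|_]; last by case: ifP.
  case: ifP => [_|/negbT nov].
    by rewrite indicE mem_set//; case: (~~ _).
  rewrite (_ : ~~ _ = false)//; apply: contraNF nov.
  exact: slot_edges_disjoint.
have bad0 : 0 <= bad t by apply: sumr_ge0 => e _; rewrite mulr_ge0.
have qm0 : 0 <= q * mean by rewrite mulr_ge0// ltW.
have qc : q * mean / 4 <= q * #|c|%:R - q * mean / 4.
  have : q * mean <= q * (#|c|%:R * 2) by rewrite ler_pM2l.
  by lra.
have h1 : (q * mean / 4) ^+ 2 <= (q * #|c|%:R - q * mean / 4) ^+ 2.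
  by rewrite lerXn2r ?nnegrE//; lra.
move=> /(le_trans (ler_wpM2l bad0 h1)) h2.
apply: (@le_trans _ _ (16 / q ^+ 2 * W)); last first.
  by rewrite lerDr mulr_ge0// sqr_ge0.
have -> : bad t * mean ^+ 2 = 16 / q ^+ 2 * (bad t * (q * mean / 4) ^+ 2).
  by field; rewrite gt_eqF.
exact: ler_wpM2l.
Qed.

End clique_bounds.

(** * The boxes used for given exponents *)

Section cell_boxes.
Context {R : realType} {tau w0 gamma : R} {d n : nat} {disp : measure_display}
  {T : measurableType disp} {P : probability T R}.
Variable G : girg tau w0 gamma d n P.
Variables (m : nat) (alpha : 'I_m.+1 -> R) (beta : 'I_m -> 'I_d -> R).
Variables (eps lam top kap sig b : R) (L : nat).

Let a := mean_weight tau w0 * n%:R.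
Let side := sig * a `^ b.
Let width := kap * a `^ b.

Notation cell := {ffun 'I_d -> 'I_L}.

(** Along each coordinate, cell [j] starts at [j * side]; the first vertex of
    the list lies within [width] of this point, and the vertex [i] of the list lies
    further right, by an amount of order [a `^ beta i h]. *)
Definition position_box (j : cell) (i : 'I_m.+1) (h : 'I_d) : set R :=
  if unlift ord0 i is Some i' then
    `](j h)%:R * side + width + eps * a `^ beta i' h,
      (j h)%:R * side + top * a `^ beta i' h]%classic
  else `](j h)%:R * side, (j h)%:R * side + width]%classic.

(** A subinterval of the weight window at place [i]. *)
Definition weight_box (i : 'I_m.+1) : set R :=
  `]lam * a `^ alpha i, a `^ alpha i / eps]%classic.

(** The box that cell [j] prescribes at place [i]. *)
Definition cell_box (j : cell) (i : 'I_m.+1) : set R * ('I_d -> set R) :=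
  (weight_box i, position_box j i).

(** The length of [position_box j i h], which does not depend on [j]. *)
Definition position_length (i : 'I_m.+1) (h : 'I_d) : R :=
  if unlift ord0 i is Some i' then (top - eps) * a `^ beta i' h - width
  else width.

(** The probability that a given vertex lies in [cell_box j i]. *)
Definition box_prob (i : 'I_m.+1) : R :=
  ((w0 / (lam * a `^ alpha i)) `^ (tau - 1) -
   (w0 / (a `^ alpha i / eps)) `^ (tau - 1)) * \prod_h position_length i h.

Hypotheses (w0_gt0 : 0 < w0) (mean_gt0 : 0 < mean_weight tau w0)
  (gamma_gt0 : 0 < gamma) (tau_gt1 : 1 < tau) (a_ge1 : 1 <= a).
Hypotheses (eps01 : 0 < eps < 1) (eps_lam : eps <= lam) (lam_eps : lam < eps^-1)
  (w0_lam : forall i, w0 <= lam * a `^ alpha i).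
Hypotheses (kap_gt0 : 0 < kap) (kap_sig : kap <= sig)
  (kap_top : eps + 2 * kap <= top) (top1 : top <= 1)
  (b_beta : forall i h, b <= beta i h)
  (top_beta : forall i h, top * a `^ beta i h <= 1 / 2)
  (L_side : L%:R * side <= 1 / 2).

Let eps_gt0 : 0 < eps. Proof. by case/andP: eps01. Qed.
Let a_gt0 : 0 < a. Proof. exact: lt_le_trans a_ge1. Qed.
Let pa_gt0 x : 0 < a `^ x. Proof. exact: powR_gt0. Qed.
Let ab_beta i h : a `^ b <= a `^ beta i h.
Proof. exact: ler_powR. Qed.
Let side_gt0 : 0 < side.
Proof. by rewrite mulr_gt0// (lt_le_trans kap_gt0). Qed.
Let width_gt0 : 0 < width. Proof. by rewrite mulr_gt0. Qed.
Let width_side : width <= side. Proof. by rewrite ler_pM2r. Qed.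
Let width_le i h : width <= kap * a `^ beta i h.
Proof. by rewrite ler_pM2l. Qed.

Let cell_le (j : cell) h : (j h)%:R * side + side <= 1 / 2.
Proof.
apply: le_trans L_side; rewrite -[X in _ + X]mul1r -mulrDl ler_pM2r// natr1.
by rewrite ler_nat.
Qed.

Let cell_ge0 (j : cell) h : 0 <= (j h)%:R * side.
Proof. by rewrite mulr_ge0// ltW. Qed.

Lemma measurable_cell_box j i : measurable_box (cell_box j i).
Proof.
split => [|h]; first exact: measurable_itv.
by rewrite /cell_box /position_box /=; case: unlift => [i'|]; exact: measurable_itv.
Qed.

Lemma position_length_ge i h :
  kap * (if unlift ord0 i is Some i' then a `^ beta i' h else a `^ b) <=
  position_length i h.
Proof.
rewrite /position_length; case: unlift => [i'|//].
have wle := width_le i' h; have r0 := pa_gt0 (beta i' h).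
have : 2 * kap * a `^ beta i' h <= (top - eps) * a `^ beta i' h.
  by rewrite ler_pM2r//; move: kap_top; lra.
by lra.
Qed.

Lemma position_length_ge0 i h : 0 <= position_length i h.
Proof.
apply: le_trans (position_length_ge i h).
by rewrite mulr_ge0 ?(ltW kap_gt0)//; case: unlift => [i'|]; exact: ltW.
Qed.

Lemma position_box_prob j i h u :
  P (position G u h @^-1` position_box j i h) = (position_length i h)%:E.
Proof.
have := position_length_ge0 i h; rewrite /position_box /position_length.
have := cell_le j h; have := cell_ge0 j h.
case: unlift => [i'|] j0 jle len0; last first.
  rewrite position_itvoc_prob//; first by congr (_%:E); ring.
    by rewrite lerDl ltW.
  by move: width_side; lra.
have r0 := pa_gt0 (beta i' h); have tr := top_beta i' h.
rewrite position_itvoc_prob//; first by congr (_%:E); ring.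
- by rewrite addr_ge0 ?(mulr_ge0 (ltW eps_gt0) (ltW r0))// addr_ge0// ltW.
- by move: len0; rewrite mulrBl; lra.
- by move: side_gt0; lra.
Qed.

Lemma cell_box_prob j i u : P (vertex_box G u (cell_box j i)) = (box_prob i)%:E.
Proof.
rewrite vertex_box_prob; last exact: measurable_cell_box.
rewrite EFinM weight_itvoc_prob//; last first.
  by rewrite mulrC ler_pM2l// ltW.
congr (_ * _)%E; rewrite -prodEFin; apply: eq_bigr => h _.
exact: position_box_prob.
Qed.

Notation index := ({ffun 'I_m.+1 -> 'I_(n %/ m.+1)} * cell)%type.

Lemma cell_boxes_in_M (u : index) t : list_event G cell_box u t ->
  in_M G eps alpha beta t (slot_list u.1).
Proof.
move=> ut; apply/and3P; split.
- by apply/injectiveP => i i'; rewrite !ffunE => /slot_inj[].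
- apply/forallP => i; have [/= hw _] := ut i I; move: hw.
  rewrite /weight_box /= !in_itv /= => /andP[lw ->]; rewrite andbT.
  by apply: le_trans (ltW lw); rewrite ler_pM2r.
- apply/forallP => i; apply/forallP => h.
  have [_ /(_ h) /=] := ut ord0 I; have [_ /(_ h) /=] := ut (lift ord0 i) I.
  rewrite /position_box unlift_none liftK /= !in_itv /=.
  set x := position _ _ _ _; set y := position _ _ _ _.
  move=> /andP[x1 x2] /andP[y1 y2].
  have r0 := pa_gt0 (beta i h); have tr := top_beta i h.
  have xy : 0 <= x - y by have := mulr_gt0 eps_gt0 r0; move: width_gt0; lra.
  rewrite /circle_dist ger0_norm// min_l; last by move: width_gt0; lra.
  apply/andP; split; first by move: width_gt0; lra.
  rewrite -/a ler_pdivlMr//; apply: (@le_trans _ _ (top * a `^ beta i h * eps)).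
    by rewrite ler_pM2r//; move: kap_top kap_gt0; lra.
  have [_ eps1] := andP eps01.
  rewrite mulrAC ler_piMl ?(ltW r0)// mulr_ile1 ?(ltW eps1) ?(ltW eps_gt0)//.
  by move: kap_top kap_gt0 eps_gt0; lra.
Qed.

Let position_box_le (j : cell) (i : 'I_m.+1) h (r x : R) : width <= r ->
  (forall i', i = lift ord0 i' -> a `^ beta i' h <= r) ->
  position_box j i h x -> (j h)%:R * side < x <= (j h)%:R * side + r.
Proof.
move=> wr; rewrite /position_box; case: (unliftP ord0 i) => [i' ->|_] ler.
  have := ler i' erefl; have r0 := pa_gt0 (beta i' h).
  have := mulr_gt0 eps_gt0 r0; move: width_gt0; rewrite /= in_itv /=.
  have : top * a `^ beta i' h <= a `^ beta i' h by rewrite ler_piMl// ltW.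
  by move=> h1 h2 h3 h4 /andP[h5 h6]; apply/andP; split; lra.
by rewrite /= in_itv /= => /andP[-> h2]; rewrite /=; lra.
Qed.

(** The bound holds because the distance between the vertices [i] and [j] of the
    list is at most [a `^ pair_scale beta i j]. *)
Lemma cell_boxes_edge (u : index) t (i j : 'I_m.+1) : (0 < d)%N -> (i < j)%N ->
  list_event G cell_box u t ->
  eps `^ (2 * gamma) * a `^ (gamma * Num.min
    (alpha i + alpha j - 1 - d%:R * pair_scale beta i j) 0) <=
  edge_prob G (slot i (u.1 i)) (slot j (u.1 j)) t.
Proof.
move=> d0 ij ut; set D := pair_scale beta i j.
set gap := alpha i + alpha j - 1 - d%:R * D.
have [j' jE] : exists j', j = lift ord0 j'.
  by case: (unliftP ord0 j) ij => [j' ->|->//] _; exists j'.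
have aD_ge k h : k = i \/ k = j ->
    forall k', k = lift ord0 k' -> a `^ beta k' h <= a `^ D.
  move=> kij k' kE; apply: ler_powR => //; rewrite /D.
  by case: kij => <-; rewrite kE; [exact: pair_scale_ge|exact: pair_scale_ger].
have width_D : width <= a `^ D.
  pose h0 := Ordinal d0.
  apply: le_trans (aD_ge j h0 (or_intror erefl) j' jE).
  apply: le_trans (width_le j' h0) _; rewrite ler_piMl ?(ltW (pa_gt0 _))//.
  by move: kap_top top1 kap_gt0 eps_gt0; lra.
have [eps0 eps1] := andP eps01.
have min0 : Num.min gap 0 <= 0 by rewrite ge_min lexx orbT.
have low1 : eps `^ (2 * gamma) * a `^ (gamma * Num.min gap 0) <= 1.
  apply: mulr_ile1; rewrite ?powR_ge0//.
    rewrite -[leRHS](powRr0 eps); apply: ger_powR; first by rewrite eps0 ltW.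
    by rewrite mulr_ge0// ltW.
  rewrite -[leRHS](powRr0 a); apply: ler_powR => //.
  by rewrite pmulr_rle0.
rewrite /edge_prob /conn_prob; set D' := torus_dist _ _.
case: eqP => [//|/eqP dist_neq0].
have dist_ge0 : 0 <= D' by exact: torus_dist_ge0.
have dist_le : D' <= a `^ D.
  apply: bigmax_le => [|h _]; first exact: powR_ge0.
  rewrite ge_min; apply/orP; left.
  have [_ /(_ h) xi] := ut i I; have [_ /(_ h) xj] := ut j I.
  move: xi xj; rewrite !ffunE => xi xj.
  have /andP[h1 h2] := position_box_le width_D (aD_ge i h (or_introl erefl)) xi.
  have /andP[h3 h4] := position_box_le width_D (aD_ge j h (or_intror erefl)) xj.
  by rewrite ler_norml; apply/andP; split; lra.
have weight_ge k : lam * a `^ alpha k <= weight G (slot k (u.1 k)) t.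
  have [/= hw _] := ut k I; move: hw; rewrite ffunE /weight_box /= in_itv /=.
  by move=> /andP[/ltW].
have distd : 0 < D' ^+ d by rewrite exprn_gt0// lt_def dist_neq0.
have distd_le : D' ^+ d <= a `^ (d%:R * D).
  rewrite mulrC powRrM powR_mulrn ?powR_ge0//.
  by rewrite lerXn2r ?nnegrE ?powR_ge0.
have ratio : eps ^+ 2 * a `^ gap <=
    weight G (slot i (u.1 i)) t * weight G (slot j (u.1 j)) t /
    (n%:R * mean_weight tau w0 * D' ^+ d).
  rewrite [n%:R * _]mulrC -/a ler_pdivlMr; last exact: mulr_gt0 a_gt0 distd.
  apply: (@le_trans _ _ (eps ^+ 2 * a `^ gap * (a * a `^ (d%:R * D)))).
    by rewrite ler_wpM2l ?mulr_ge0 ?powR_ge0 ?sqr_ge0 ?(ltW eps0)// ler_pM2l.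
  have -> : eps ^+ 2 * a `^ gap * (a * a `^ (d%:R * D)) =
      (eps * a `^ alpha i) * (eps * a `^ alpha j).
    rewrite -{2}(powRr1 (ltW a_gt0)) -mulrA -!powRD ?(gt_eqF a_gt0) ?implybT//.
    rewrite (_ : gap + (1 + d%:R * D) = alpha i + alpha j); last first.
      by rewrite /gap; ring.
    rewrite powRD ?(gt_eqF a_gt0) ?implybT//; ring.
  have epslam k : eps * a `^ alpha k <= weight G (slot k (u.1 k)) t.
    by apply: le_trans (weight_ge k); rewrite ler_pM2r.
  by apply: ler_pM => //; rewrite mulr_ge0 ?powR_ge0// ltW.
rewrite le_min low1 andbT.
apply: (@le_trans _ _ ((eps ^+ 2 * a `^ gap) `^ gamma)); last first.
  apply: ge0_ler_powR => //; rewrite ?nnegrE ?(ltW gamma_gt0)//.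
    by rewrite mulr_ge0 ?sqr_ge0 ?powR_ge0.
  by apply: le_trans ratio; rewrite mulr_ge0 ?sqr_ge0 ?powR_ge0.
rewrite powRM ?sqr_ge0 ?powR_ge0// -powRrM -powR_mulrn ?(ltW eps0)// -powRrM.
rewrite ler_wpM2l ?powR_ge0//; apply: ler_powR => //.
by rewrite mulrC ler_pM2r// ge_min lexx.
Qed.

Let same_cell (x : R) (j j' : 'I_L) : j%:R * side < x <= j%:R * side + side ->
  j'%:R * side < x <= j'%:R * side + side -> j = j'.
Proof.
move=> /andP[h1 h2] /andP[h3 h4].
have lt_cell (k k' : 'I_L) : k%:R * side < k'%:R * side + side -> (k <= k')%N.
  rewrite -[X in _ + X]mul1r -mulrDl ltr_pM2r// natr1 ltr_nat ltnS.
  by [].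
apply/val_inj/anti_leq; rewrite !lt_cell//.
  exact: lt_le_trans h3 h2.
exact: lt_le_trans h1 h4.
Qed.

Lemma cell_boxes_cell (v : {ffun 'I_m.+1 -> 'I_(n %/ m.+1)}) (j j' : cell) t :
  list_event G cell_box (v, j) t -> list_event G cell_box (v, j') t -> j = j'.
Proof.
move=> vj vj'; apply/ffunP => h.
have [_ /(_ h) /=] := vj ord0 I; have [_ /(_ h) /=] := vj' ord0 I.
rewrite /position_box unlift_none /= !in_itv /= ffunE => /andP[h1 h2] /andP[h3 h4].
by apply: (@same_cell (position G (slot ord0 (v ord0)) h t));
  apply/andP; move: width_side; split => //; lra.
Qed.

Lemma cell_boxes_disjoint : (forall i h, top * a `^ beta i h <= side) ->
  forall i w t j j', vertex_box G w (cell_box j i) t ->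
  vertex_box G w (cell_box j' i) t -> j = j'.
Proof.
move=> top_side i w t j j' [_ hj] [_ hj']; apply/ffunP => h.
have in_cell (k : cell) : position_box k i h (position G w h t) ->
    (k h)%:R * side < position G w h t <= (k h)%:R * side + side.
  rewrite /position_box; case: unlift => [i'|] /=; rewrite in_itv /= => /andP[h1 h2].
    apply/andP; split; last by have := top_side i' h; lra.
    by have := mulr_gt0 eps_gt0 (pa_gt0 (beta i' h)); move: width_gt0; lra.
  by apply/andP; split => //; move: width_side; lra.
exact: same_cell (in_cell _ (hj h)) (in_cell _ (hj' h)).
Qed.

(** ** Lower bounds by powers of [n] *)

(** The probability of the weight box at place [i] is this constant times
    [a `^ ((1 - tau) * alpha i)]. *)
Definition weight_const : R :=
  w0 `^ (tau - 1) * (lam^-1 `^ (tau - 1) - eps `^ (tau - 1)).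

(** [weight_const] times a lower bound for the proportion [(n %/ m.+1) / a] of
    vertices in a class. *)
Definition slot_const : R :=
  weight_const / (2 * m.+1%:R * mean_weight tau w0).

(** The constant of the lower bound for the expected number of lists. *)
Definition mean_const : R :=
  (4 * sig)^-1 ^+ d * (slot_const ^+ m.+1 * (kap ^+ d) ^+ m.+1).

(** The constant of the lower bound for the conditional probability that all
    the edges of a list are present. *)
Definition edge_const : R :=
  \prod_(i < m.+1) \prod_(j < m.+1 | (i < j)%N) eps `^ (2 * gamma).

Hypotheses (n_large : (m.+1 <= n)%N) (L_large : 1 <= 4 * (L%:R * side)).

Let M := (n %/ m.+1)%N.

Lemma weight_const_gt0 : 0 < weight_const.
Proof.
rewrite mulr_gt0 ?powR_gt0// subr_gt0; apply: gt0_ltr_powR.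
- by rewrite subr_gt0.
- by rewrite nnegrE ltW.
- by rewrite nnegrE invr_ge0 (le_trans (ltW eps_gt0)).
- by rewrite -[ltLHS]invrK ltf_pV2 ?posrE ?invr_gt0// (lt_le_trans eps_gt0).
Qed.

Lemma slot_const_gt0 : 0 < slot_const.
Proof.
by rewrite divr_gt0 ?weight_const_gt0// mulr_gt0// mulr_gt0// ltr0n.
Qed.

Lemma mean_const_gt0 : 0 < mean_const.
Proof.
have sig0 := lt_le_trans kap_gt0 kap_sig.
rewrite mulr_gt0//; first by rewrite exprn_gt0// invr_gt0 mulr_gt0.
by rewrite mulr_gt0// exprn_gt0 ?slot_const_gt0// exprn_gt0.
Qed.

Lemma edge_const_gt0 : 0 < edge_const.
Proof. by apply: prodr_gt0 => i _; apply: prodr_gt0 => j _; rewrite powR_gt0. Qed.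

Let weight_probE i :
  (w0 / (lam * a `^ alpha i)) `^ (tau - 1) -
  (w0 / (a `^ alpha i / eps)) `^ (tau - 1) =
  weight_const * a `^ ((1 - tau) * alpha i).
Proof.
have lam0 : 0 < lam := lt_le_trans eps_gt0 eps_lam.
have -> : (1 - tau) * alpha i = - alpha i * (tau - 1) by ring.
rewrite !invfM invrK -powRN.
rewrite !(powRM (tau - 1) (ltW w0_gt0)) ?mulr_ge0 ?invr_ge0 ?powR_ge0 ?ltW//.
rewrite !(powRM (tau - 1)) ?invr_ge0 ?powR_ge0 ?ltW//.
by rewrite -powRrM /weight_const; ring.
Qed.

Let slots_ge : a / (2 * m.+1%:R * mean_weight tau w0) <= M%:R.
Proof.
rewrite /a ler_pdivrMr; last by rewrite mulr_gt0// mulr_gt0// ltr0n.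
rewrite mulrC [leRHS]mulrA ler_pM2r// [2 * _]mulrC mulrA -!natrM ler_nat.
have M1 : (0 < M)%N by rewrite divn_gt0.
have := ltn_ceil n (ltn0Sn m); rewrite -/M => nM.
apply: leq_trans (ltnW nM) _.
by rewrite mulnAC leq_mul2r muln2 -addnn -[X in (X <= _)%N]addn1 leq_add2l M1 orbT.
Qed.

Let scale i h := if unlift ord0 i is Some i' then a `^ beta i' h else a `^ b.

Lemma slot_mean_ge i :
  slot_const * a `^ (1 + (1 - tau) * alpha i) * \prod_h (kap * scale i h) <=
  M%:R * box_prob i.
Proof.
rewrite /box_prob mulrA weight_probE.
apply: ler_pM.
- by rewrite mulr_ge0 ?powR_ge0// ltW// slot_const_gt0.
- apply: prodr_ge0 => h _; rewrite mulr_ge0 ?(ltW kap_gt0)// /scale.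
  by case: unlift => *; rewrite powR_ge0.
- rewrite powRD ?(gt_eqF a_gt0) ?implybT// powRr1 ?(ltW a_gt0)//.
  have -> : slot_const * (a * a `^ ((1 - tau) * alpha i)) =
    a / (2 * m.+1%:R * mean_weight tau w0) *
      (weight_const * a `^ ((1 - tau) * alpha i)) by rewrite /slot_const; ring.
  by rewrite ler_wpM2r// mulr_ge0 ?powR_ge0// ltW// weight_const_gt0.
- apply: ler_prod => h _; rewrite position_length_ge andbT.
  rewrite mulr_ge0 ?(ltW kap_gt0)// /scale.
  by case: unlift => *; rewrite powR_ge0.
Qed.

Lemma box_prob_ge0 i : 0 <= box_prob i.
Proof.
rewrite /box_prob weight_probE mulr_ge0//.
  by rewrite mulr_ge0 ?powR_ge0// ltW// weight_const_gt0.
by apply: prodr_ge0 => h _; exact: position_length_ge0.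
Qed.

Let prod_powR (I : finType) (Pr : pred I) (f : I -> R) :
  \prod_(i | Pr i) a `^ f i = a `^ (\sum_(i | Pr i) f i).
Proof.
elim/big_rec2: _ => [|i y x _ ->]; first by rewrite powRr0.
by rewrite powRD// (gt_eqF a_gt0) implybT.
Qed.

Let cells_ge : (4 * sig)^-1 ^+ d <= (L%:R * a `^ b) ^+ d.
Proof.
have sig0 := lt_le_trans kap_gt0 kap_sig.
rewrite lerXn2r ?nnegrE//; first by rewrite invr_ge0 mulr_ge0// ltW.
  by rewrite mulr_ge0// powR_ge0.
rewrite -div1r ler_pdivrMr ?mulr_gt0//.
by move: L_large; rewrite /side; lra.
Qed.

Lemma mean_count_ge :
  mean_const * a `^ (m.+1%:R + (1 - tau) * (\sum_i alpha i) +
    \sum_i \sum_h beta i h) <= mean_count M cell box_prob.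
Proof.
rewrite /mean_count card_ffun !card_ord natrX.
apply: (@le_trans _ _ (L%:R ^+ d * \prod_i (slot_const *
    a `^ (1 + (1 - tau) * alpha i) * \prod_h (kap * scale i h)))); last first.
  rewrite ler_wpM2l ?exprn_ge0//; apply: ler_prod => i _.
  rewrite slot_mean_ge andbT mulr_ge0//.
    by rewrite mulr_ge0 ?powR_ge0// ltW// slot_const_gt0.
  apply: prodr_ge0 => h _; rewrite mulr_ge0 ?(ltW kap_gt0)// /scale.
  by case: unlift => *; rewrite powR_ge0.
have -> : \prod_i (slot_const * a `^ (1 + (1 - tau) * alpha i) *
     \prod_h (kap * scale i h)) =
   (slot_const ^+ m.+1 * (kap ^+ d) ^+ m.+1) * (a `^ b ^+ d) *
   a `^ (m.+1%:R + (1 - tau) * (\sum_i alpha i) + \sum_i \sum_h beta i h).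
  move: slot_const => S; rewrite !big_split /= prodr_const card_ord prod_powR.
  under [X in _ * X = _]eq_bigr do rewrite big_split prodr_const card_ord /=.
  rewrite [X in _ * X = _]big_split /= prodr_const card_ord.
  have -> : \prod_(i < m.+1) \prod_(h < d) scale i h =
      a `^ b ^+ d * a `^ (\sum_i \sum_h beta i h).
    rewrite big_ord_recl -prod_powR; congr (_ * _).
      by rewrite /scale unlift_none prodr_const card_ord.
    apply: eq_bigr => i _; rewrite -prod_powR; apply: eq_bigr => h _.
    by rewrite /scale liftK.
  rewrite big_split /= sumr_const card_ord -mulr_sumr.
  by rewrite [in RHS]powRD ?(gt_eqF a_gt0) ?implybT//; ring.
rewrite /mean_const !mulrA ler_wpM2r ?powR_ge0//.
set C := slot_const ^+ m.+1; set K := (kap ^+ d) ^+ m.+1.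
have C0 : 0 <= C by rewrite exprn_ge0// ltW// slot_const_gt0.
have K0 : 0 <= K by rewrite !exprn_ge0// ltW.
have -> : L%:R ^+ d * C * K * a `^ b ^+ d = (L%:R * a `^ b) ^+ d * C * K.
  by rewrite exprMn; ring.
by rewrite ler_wpM2r// ler_wpM2r.
Qed.

Let gap i j := alpha i + alpha j - 1 - d%:R * pair_scale beta i j.

(** A lower bound for the conditional probability that all the edges of a list
    in its boxes are present. *)
Definition edge_bound : R :=
  \prod_(i < m.+1) \prod_(j < m.+1 | (i < j)%N)
    (eps `^ (2 * gamma) * a `^ (gamma * Num.min (gap i j) 0)).

Lemma edge_boundE : edge_bound = edge_const * a `^
  (\sum_(i < m.+1) \sum_(j < m.+1 | (i < j)%N) gamma * Num.min (gap i j) 0).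
Proof.
rewrite /edge_bound -prod_powR -big_split; apply: eq_bigr => i _ /=.
by rewrite big_split /= prod_powR.
Qed.

Lemma edge_bound_gt0 : 0 < edge_bound.
Proof. by rewrite edge_boundE mulr_gt0 ?powR_gt0// edge_const_gt0. Qed.

Lemma edge_mean_ge : edge_const * mean_const * a `^ exponent tau gamma alpha beta
  <= edge_bound * mean_count M cell box_prob.
Proof.
rewrite /exponent powRD ?(gt_eqF a_gt0) ?implybT// edge_boundE.
set e1 := a `^ _; set e2 := a `^ _;
have -> : edge_const * mean_const * (e1 * e2) =
  edge_const * e2 * (mean_const * e1) by ring.
rewrite ler_wpM2l ?mean_count_ge// mulr_ge0 ?powR_ge0// ltW//.
exact: edge_const_gt0.
Qed.

Hypothesis d_gt0 : (0 < d)%N.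

Let edge_bound_le (u : index) t : list_event G cell_box u t ->
  edge_bound <= \prod_(i < m.+1) \prod_(j < m.+1 | (i < j)%N)
    edge_prob G (slot i (u.1 i)) (slot j (u.1 j)) t.
Proof.
move=> ut; apply: ler_prod => i _; apply/andP; split.
  by apply: prodr_ge0 => j _; rewrite mulr_ge0 ?powR_ge0.
apply: ler_prod => j ij; rewrite mulr_ge0 ?powR_ge0//=.
exact: cell_boxes_edge.
Qed.

Lemma expected_clique_count_ge_powR :
  ((edge_const * mean_const * a `^ exponent tau gamma alpha beta)%:E <=
   'E_P[fun t => (clique_count G eps alpha beta t)%:R])%E.
Proof.
apply: (@le_trans _ _ (edge_bound * mean_count M cell box_prob)%:E).
  by rewrite lee_fin edge_mean_ge.
apply: (@expected_clique_count_ge _ _ _ _ _ _ _ _ _ G (ltW mean_gt0) _ _ _ _ _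
  cell_box).
- exact: measurable_cell_box.
- exact: cell_box_prob.
- exact: cell_boxes_in_M.
- exact: cell_boxes_cell.
- exact: ltW edge_bound_gt0.
- exact: edge_bound_le.
Qed.

(** Concentration, when all the distances are of the order of the side of the
    cells, no edge has a vanishing conditional probability, the expected number
    of candidates for a place in a cell is bounded below, and the expected
    number of candidates for a place is at least of order [a `^ eta]. *)
Lemma clique_count_le_prob_powR (eta : R) :
  (forall i h, beta i h = b) -> top <= sig ->
  (forall i j : 'I_m.+1, (i < j)%N -> 0 <= gap i j) ->
  (forall i, 0 <= 1 + (1 - tau) * alpha i + d%:R * b) ->
  (forall i, eta <= 1 + (1 - tau) * alpha i) ->
  (P [set t | ((clique_count G eps alpha beta t)%:R <=
       edge_const * mean_const / 4 * a `^ exponent tau gamma alpha beta :> R)%R]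
   <= ((4 + 16 / edge_const ^+ 2) * (m.+1%:R *
         (1 + (slot_const * kap ^+ d)^-1) ^+ m.+1 /
         ((4 * sig)^-1 ^+ d * (slot_const * kap ^+ d) * a `^ eta)))%:E)%E.
Proof.
move=> beta_b top_sig gap0 exp0 exp_eta; set c1 := slot_const * kap ^+ d.
have c1_gt0 : 0 < c1 by rewrite mulr_gt0 ?slot_const_gt0// exprn_gt0.
have edgeE : edge_bound = edge_const.
  rewrite edge_boundE big1 ?powRr0 ?mulr1// => i _; apply: big1 => j ij.
  by rewrite min_r ?mulr0// gap0.
have scaleE i h : scale i h = a `^ b.
  by rewrite /scale; case: unlift => // i'; rewrite beta_b.
have slotE i : c1 * (a `^ (1 + (1 - tau) * alpha i) * (a `^ b) ^+ d) <=
    M%:R * box_prob i.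
  apply: le_trans (slot_mean_ge i); rewrite /c1.
  under eq_bigr do rewrite scaleE.
  by rewrite prodr_const card_ord exprMn le_eqVlt; apply/orP; left; apply/eqP; ring.
have slot1 i : c1 <= M%:R * box_prob i.
  apply: le_trans (slotE i); rewrite ler_peMr ?(ltW c1_gt0)//.
  rewrite -powR_mulrn ?powR_ge0// -powRrM -powRD ?(gt_eqF a_gt0) ?implybT//.
  by rewrite -[leLHS](powRr0 a); apply: ler_powR => //; rewrite [b * _]mulrC.
set D := (4 * sig)^-1 ^+ d * c1 * a `^ eta.
have sig0 := lt_le_trans kap_gt0 kap_sig.
have s0 : 0 < (4 * sig)^-1 ^+ d by rewrite exprn_gt0// invr_gt0 mulr_gt0.
have D0 : 0 < D by apply: mulr_gt0 => //; apply: mulr_gt0.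
have slotD i : D <= #|{: cell}|%:R * (M%:R * box_prob i).
  rewrite card_ffun !card_ord natrX.
  apply: (@le_trans _ _ (L%:R ^+ d *
      (c1 * (a `^ (1 + (1 - tau) * alpha i) * (a `^ b) ^+ d)))); last first.
    by rewrite ler_wpM2l// exprn_ge0.
  have -> : L%:R ^+ d * (c1 * (a `^ (1 + (1 - tau) * alpha i) * a `^ b ^+ d)) =
    (L%:R * a `^ b) ^+ d * c1 * a `^ (1 + (1 - tau) * alpha i).
    by rewrite exprMn; ring.
  apply: ler_pM; rewrite ?powR_ge0//; first by rewrite ltW// mulr_gt0.
    by rewrite ler_wpM2r ?(ltW c1_gt0).
  exact: ler_powR.
set mean := mean_count M cell box_prob.
have mean_gt0' : 0 < mean.
  apply: lt_le_trans mean_count_ge.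
  by rewrite mulr_gt0 ?powR_gt0// mean_const_gt0.
have top_side i h : top * a `^ beta i h <= side.
  by rewrite beta_b ler_pM2r.
have main := @clique_count_le_prob _ _ _ _ _ _ _ _ _ G (ltW mean_gt0) m eps alpha
  beta cell cell_box box_prob measurable_cell_box cell_box_prob cell_boxes_in_M
  cell_boxes_cell edge_bound (ltW edge_bound_gt0) edge_bound_le edge_bound_gt0
  box_prob_ge0
  (cell_boxes_disjoint top_side).
have O_le := overlap_count_le box_prob_ge0 c1_gt0 D0 slot1 slotD.
rewrite card_ord -/mean in O_le.
apply: (@le_trans _ _ (P [set t | ((clique_count G eps alpha beta t)%:R <=
    edge_bound * mean / 4 :> R)%R])).
  apply: le_measure; rewrite ?inE; try exact: measurable_clique_count_le.
  move=> t /= /le_trans; apply.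
  have := edge_mean_ge; rewrite -/mean; lra.
set pr := P _ in main *.
have m2 : 0 < mean ^+ 2 by rewrite exprn_gt0.
rewrite -(@lee_pmul2l _ (mean ^+ 2)%:E)//.
apply: le_trans main _; rewrite edgeE -EFinM lee_fin.
rewrite [leRHS]mulrCA ler_wpM2l//.
by rewrite addr_ge0// divr_ge0// sqr_ge0.
Qed.

End cell_boxes.

Arguments edge_const {R} gamma m eps.
Arguments slot_const {R} tau w0 m eps lam.
Arguments mean_const {R} tau w0 d m eps lam kap sig.

(** * Asymptotics *)

Section asymptotics.
Context {R : realType}.

Lemma near_powR_ge (mu x C : R) : 0 < mu -> 0 < x ->
  \forall n \near \oo, C <= (mu * n%:R) `^ x.
Proof.
move=> mu0 x0; pose C1 := Num.max C 1.
have C10 : 0 <= C1 by rewrite le_max ler01 orbT.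
near=> n; apply: (@le_trans _ _ C1); first by rewrite le_max lexx.
have -> : C1 = (C1 `^ x^-1) `^ x by rewrite -powRrM mulVf ?gt_eqF// powRr1.
have le_n : C1 `^ x^-1 <= mu * n%:R.
  rewrite mulrC -ler_pdivrMr//; near: n; exact: nbhs_infty_ger.
apply: ge0_ler_powR => //; rewrite ?nnegrE ?powR_ge0 ?ltW//.
by apply: lt_le_trans le_n; rewrite powR_gt0// lt_max ltr01 orbT.
Unshelve. all: by end_near. Qed.

Lemma near_powR_le (mu x e : R) : 0 < mu -> x < 0 -> 0 < e ->
  \forall n \near \oo, (mu * n%:R) `^ x <= e.
Proof.
move=> mu0 x0 e0; near=> n.
rewrite -[x]opprK powRN -[leRHS]invrK lef_pV2 ?posrE ?invr_gt0//.
  by near: n; apply: near_powR_ge => //; rewrite oppr_gt0.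
have : e^-1 <= (mu * n%:R) `^ (- x).
  by near: n; apply: near_powR_ge => //; rewrite oppr_gt0.
by apply: lt_le_trans; rewrite invr_gt0.
Unshelve. all: by end_near. Qed.

Lemma limn_einf_ge (u : nat -> \bar R) (c : \bar R) :
  (\forall n \near \oo, (c <= u n)%E) -> (c <= limn_einf u)%E.
Proof.
move=> [N _ cu]; rewrite limn_einf_lim; apply: lime_ge.
  exact: is_cvg_einfs.
exists N => // n /= Nn; apply: le_ereal_inf_tmp => _ [k /= nk <-].
by apply: cu => /=; exact: leq_trans nk.
Qed.

Lemma cvg_inv_powR (mu x K : R) : 0 < mu -> 0 < x ->
  (fun n => (K / (mu * n%:R) `^ x)%:E) @ \oo --> 0%E.
Proof.
move=> mu0 x0; apply: cvg_EFin; first exact: nearW.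
apply/cvgrPdist_le => e e0; near=> n.
have pge : (`|K| + 1) / e <= (mu * n%:R) `^ x.
  by near: n; exact: near_powR_ge.
have K1 : 0 < `|K| + 1 by rewrite ltr_pwDr.
have p0 : 0 < (mu * n%:R) `^ x by apply: lt_le_trans pge; rewrite divr_gt0.
rewrite sub0r normrN normrM normfV (ger0_norm (ltW p0)) ler_pdivrMr//.
rewrite mulrC; move: pge; rewrite ler_pdivrMr//; apply: le_trans.
by rewrite lerDl.
Unshelve. all: by end_near. Qed.

Variables (w0 eps mu : R) (d m : nat).
Variables (alpha : 'I_m.+1 -> R) (beta : 'I_m -> 'I_d -> R).
Hypotheses (mu_gt0 : 0 < mu) (eps01 : 0 < eps < 1) (w0_gt0 : 0 < w0)
  (alpha_ge0 : forall i, 0 <= alpha i) (beta_le0 : forall i h, beta i h <= 0)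
  (reachable : windows_reachable w0 eps alpha beta).

Lemma near_ge1 : \forall n \near \oo, 1 <= mu * n%:R.
Proof.
near=> n; rewrite mulrC -ler_pdivrMr//; near: n; exact: nbhs_infty_ger.
Unshelve. all: by end_near. Qed.

(** The lower end of a subinterval of the weight windows above [w0]. *)
Lemma exists_weight_bound : exists2 lam, eps <= lam < eps^-1 &
  \forall n \near \oo, forall i, w0 <= lam * (mu * n%:R) `^ alpha i.
Proof.
have [eps0 eps1] := andP eps01; have [reach_w _] := reachable.
have epsV : eps < eps^-1 by rewrite (lt_trans eps1)// invf_gt1.
have [[i0 al0]|no0] := pselect (exists i, alpha i = 0).
  exists (Num.max eps w0).
    rewrite le_max lexx gt_max epsV /= -(ltr_pM2l eps0) divff ?gt_eqF//.
    exact: reach_w al0.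
  near=> n => i; have n1 : 1 <= mu * n%:R by near: n; exact: near_ge1.
  apply: (@le_trans _ _ (Num.max eps w0)); first by rewrite le_max lexx orbT.
  rewrite ler_peMr//; first by rewrite le_max (ltW eps0).
  by rewrite -[leLHS](powRr0 (mu * n%:R)); exact: ler_powR.
exists eps; first by rewrite lexx.
apply: filter_forall => i; near=> n; rewrite -ler_pdivrMl//.
near: n; apply: near_powR_ge => //; rewrite lt_neqAle alpha_ge0 andbT eq_sym.
by apply/eqP => al0; apply: no0; exists i.
Unshelve. all: by end_near. Qed.

(** The upper end of a subinterval of the distance windows, below 1/2 and thus
    free of the wrap-around of the circle. *)
Lemma exists_distance_bound : exists2 top, eps < top <= 1 &
  \forall n \near \oo, forall i h, top * (mu * n%:R) `^ beta i h <= 1 / 2.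
Proof.
have [eps0 eps1] := andP eps01; have [_ reach_b] := reachable.
have [[[i0 h0] be0]|no0] := pselect (exists p : 'I_m * 'I_d, beta p.1 p.2 = 0).
  exists (1 / 2); first by rewrite (reach_b _ _ be0) /=; lra.
  near=> n => i h; have n1 : 1 <= mu * n%:R by near: n; exact: near_ge1.
  rewrite -[leRHS]mulr1 ler_pM2l ?divr_gt0//.
  by rewrite -[leRHS](powRr0 (mu * n%:R)); exact: ler_powR.
exists 1; first by rewrite eps1 lexx.
apply: filter_forall => i; apply: filter_forall => h; near=> n; rewrite mul1r.
near: n; apply: near_powR_le => //; rewrite ?divr_gt0//.
rewrite lt_neqAle beta_le0 andbT.
by apply/eqP => be0; apply: no0; exists (i, h).
Unshelve. all: by end_near. Qed.

End asymptotics.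

Lemma exists_cell_number {R : realType} (side : R) : 0 < side <= 1 / 2 ->
  exists2 L : nat, L%:R * side <= 1 / 2 & 1 <= 4 * (L%:R * side).
Proof.
move=> /andP[s0 s2]; exists (Num.trunc (1 / (2 * side))).
  have : (Num.trunc (1 / (2 * side)))%:R <= 1 / (2 * side).
    by rewrite truncn_le divr_ge0// mulr_ge0// ltW.
  by rewrite ler_pdivlMr ?mulr_gt0//; lra.
have ge1 : (1 <= Num.trunc (1 / (2 * side)))%N.
  by rewrite truncn_gt0 ler_pdivlMr ?mulr_gt0//; lra.
have : 1 / (2 * side) < (Num.trunc (1 / (2 * side))).+1%:R.
  have [] := andP (@truncn_itv _ (1 / (2 * side)) _) => //.
  by rewrite divr_ge0// mulr_ge0// ltW.
rewrite ltr_pdivrMr ?mulr_gt0// -natr1.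
have : 1 <= (Num.trunc (1 / (2 * side)))%:R :> R by rewrite ler1n.
by set L := _%:R; nra.
Qed.

Lemma mean_weight_gt0 {R : realType} (tau w0 : R) : 2 < tau -> 0 < w0 ->
  0 < mean_weight tau w0.
Proof. by move=> t2 w0_gt0; rewrite mulr_gt0// divr_gt0; lra. Qed.

(** The windows grow when [eps] decreases. *)
Lemma clique_count_le_eps {R : realType} {tau w0 gamma : R} {d n : nat}
    {disp : measure_display} {T : measurableType disp} {P : probability T R}
    (G : girg tau w0 gamma d n P) (m : nat) (alpha : 'I_m.+1 -> R)
    (beta : 'I_m -> 'I_d -> R) (eps eps' : R) t : 0 < eps -> eps <= eps' ->
  (clique_count G eps' alpha beta t <= clique_count G eps alpha beta t)%N.
Proof.
move=> eps0 le_eps.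
have win eta x : x \in window tau w0 eps' eta n -> x \in window tau w0 eps eta n.
  rewrite /window !in_itv /=.
  have := powR_ge0 (mean_weight tau w0 * n%:R) eta.
  set p := _ `^ eta => p0 /andP[h1 h2]; apply/andP; split.
    by apply: le_trans h1; rewrite ler_wpM2r.
  by apply: le_trans h2 _; rewrite ler_wpM2l// lef_pV2 ?posrE// (lt_le_trans eps0).
apply: subset_leq_card; apply/fintype.subsetP => K /asboolP /and3P[cK qK].
move=> /existsP[v /andP[/and3P[vi vw vp] /eqP vK]].
apply/asboolP/and3P; split => //; apply/existsP; exists v; rewrite vK eqxx andbT.
apply/and3P; split => //.
  by apply/forallP => i; apply: win; exact: (forallP vw i).
apply/forallP => i; apply/forallP => h; apply: win.
exact: (forallP (forallP vp i) h).
Qed.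

Section theorem_parts.
Context {R : realType} {tau w0 gamma : R} {d : nat}.
Hypotheses (htau : 2 < tau < 3) (hw0 : 0 < w0) (hgamma : 1 < gamma)
  (hd : (1 <= d)%N).
Context {disp : nat -> measure_display} {T : forall n, measurableType (disp n)}
  {P : forall n, probability (T n) R}.
Variable G : forall n, girg tau w0 gamma d n (P n).
Context {m : nat}.
Hypothesis hk : (2 <= m.+1)%N.

Let mu := mean_weight tau w0.
Let mu_gt0 : 0 < mu.
Proof. by case/andP: htau => *; exact: mean_weight_gt0. Qed.
Let tau_gt1 : 1 < tau. Proof. by case/andP: htau => *; lra. Qed.
Let gamma_gt0 : 0 < gamma. Proof. by move: hgamma => *; lra. Qed.

Lemma expected_clique_count_Omega (eps : R) (alpha : 'I_m.+1 -> R)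
    (beta : 'I_m -> 'I_d -> R) : 0 < eps < 1 ->
  (forall i, 0 <= alpha i) -> (forall i h, beta i h <= 0) ->
  windows_reachable w0 eps alpha beta ->
  is_Omega
    (fun n => 'E_(P n)[fun t : T n =>
       (clique_count (G n) eps alpha beta t)%:R]%E)
    (fun n => n%:R `^ exponent tau gamma alpha beta).
Proof.
move=> eps01 al0 be0 reach; have [eps0 eps1] := andP eps01.
have [lam /andP[eps_lam lam_eps] near_lam] :=
  exists_weight_bound mu_gt0 eps01 al0 reach.
have [top /andP[eps_top top1] near_top] :=
  exists_distance_bound mu_gt0 eps01 be0 reach.
(* The sum of all the [beta i h] is below each of them, since none is
   positive; the side of the cells may be as small as the smallest distance. *)
pose kap := (top - eps) / 2; pose b := \sum_i \sum_h beta i h.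
have kap0 : 0 < kap by rewrite divr_gt0// subr_gt0.
have b_le i h : b <= beta i h.
  rewrite /b (bigD1 i)//= (bigD1 h)//= -addrA gerDl.
  rewrite -[leRHS]addr0 lerD//; first by apply: sumr_le0.
  by apply: sumr_le0 => i' _; apply: sumr_le0.
set f := exponent _ _ _ _.
pose C := edge_const gamma m eps * mean_const tau w0 d m eps lam kap kap.
have C0 : 0 < C.
  by rewrite mulr_gt0//; [exact: edge_const_gt0 | exact: mean_const_gt0].
rewrite /is_Omega; apply: (@lt_le_trans _ _ (C * mu `^ f)%:E).
  by rewrite lte_fin mulr_gt0// powR_gt0.
apply: limn_einf_ge; near=> n.
have a1 : 1 <= mu * n%:R by near: n; exact: near_ge1.
have n_large : (m.+1 <= n)%N by near: n; exact: nbhs_infty_ge.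
have n0 : 0 < n%:R :> R by rewrite ltr0n (leq_trans _ n_large).
have w0_lam i : w0 <= lam * (mu * n%:R) `^ alpha i.
  by move: i; near: n.
have top_beta i h : top * (mu * n%:R) `^ beta i h <= 1 / 2.
  by move: i h; near: n.
have side_le : kap * (mu * n%:R) `^ b <= 1 / 2.
  have m0 : (0 < m)%N by [].
  apply: le_trans (top_beta (Ordinal m0) (Ordinal hd)).
  apply: ler_pM; rewrite ?powR_ge0 ?(ltW kap0)//; first by rewrite /kap; lra.
  exact: ler_powR.
have [L L1 L2] : exists2 L : nat, L%:R * (kap * (mu * n%:R) `^ b) <= 1 / 2 &
    1 <= 4 * (L%:R * (kap * (mu * n%:R) `^ b)).
  apply: exists_cell_number; rewrite side_le andbT mulr_gt0// powR_gt0//.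
  exact: lt_le_trans a1.
have kap_top : eps + 2 * kap <= top by rewrite /kap; lra.
have E_ge := expected_clique_count_ge_powR (G n) hw0 mu_gt0 gamma_gt0 tau_gt1 a1
  eps01 eps_lam lam_eps w0_lam kap0 (lexx kap) kap_top top1 b_le top_beta L1
  n_large L2 hd.
rewrite lee_pdivlMr ?powR_gt0//; apply: le_trans E_ge.
by rewrite -EFinM lee_fin (powRM _ (ltW mu_gt0) (ltW n0)) mulrA.
Unshelve. all: by end_near. Qed.

Lemma clique_count_star_whp : m.+1%:R <> 2 / (3 - tau) ->
  let alphas : 'I_m.+1 -> R := @alpha_star R tau m in
  let betas : 'I_m -> 'I_d -> R := @beta_star R tau d m in
  forall eps0 : R, 0 < eps0 < 1 -> windows_reachable w0 eps0 alphas betas ->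
  exists2 c : R, 0 < c &
  forall eps : R, 0 < eps <= eps0 ->
    (fun n => P n [set t | (clique_count (G n) eps alphas betas t)%:R
                   / n%:R `^ exponent tau gamma alphas betas <= c])
      @ \oo --> 0%E.
Proof.
move=> /eqP kneq alphas betas eps0 eps01 reach.
have [t2 t3] := andP htau; have [eps0_gt0 eps0_lt1] := andP eps01.
pose large := 2 / (3 - tau) < m.+1%:R.
pose al : R := if large then 1 / 2 else 0.
pose b : R := if large then 0 else - (1 / d%:R).
have dn0 : d%:R != 0 :> R by rewrite pnatr_eq0 -lt0n.
have d0 : 0 < d%:R :> R by rewrite ltr0n.
have alphasE i : alphas i = al by [].
have betasE i h : betas i h = b by [].
have al0 i : 0 <= alphas i.
  by rewrite alphasE /al; case: ifP => _; rewrite ?divr_ge0.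
have be0 i h : betas i h <= 0.
  by rewrite betasE /b; case: ifP => _; rewrite ?oppr_le0 ?divr_ge0.
have db : d%:R * b = if large then 0 else - 1.
  by rewrite /b; case: ifP => _; rewrite ?mulr0// mulrN mulrA mulr1 divff.
have gap0 (i j : 'I_m.+1) : (i < j)%N ->
    0 <= alphas i + alphas j - 1 - d%:R * pair_scale betas i j.
  move=> ij; rewrite (pair_scale_const b hd ij) db !alphasE /al.
  by case: ifP => _; lra.
pose eta := 1 + (1 - tau) * al.
have eta0 : 0 < eta by rewrite /eta /al; case: ifP => _; lra.
have exp0 i : 0 <= 1 + (1 - tau) * alphas i + d%:R * b.
  rewrite db alphasE /al; case: ifP => _; lra.
have [lam /andP[eps_lam lam_eps] near_lam] :=
  exists_weight_bound mu_gt0 eps01 al0 reach.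
have [top /andP[eps_top top1] near_top] :=
  exists_distance_bound mu_gt0 eps01 be0 reach.
pose kap := (top - eps0) / 2.
have kap0 : 0 < kap by rewrite divr_gt0// subr_gt0.
have kap_le : kap <= top by rewrite /kap; lra.
have kap_top : eps0 + 2 * kap <= top by rewrite /kap; lra.
have top0 : 0 < top by exact: lt_trans eps_top.
set f := exponent _ _ _ _.
pose Ce := edge_const gamma m eps0.
pose C := Ce * mean_const tau w0 d m eps0 lam kap top.
have C0 : 0 < C.
  by rewrite mulr_gt0//; [exact: edge_const_gt0 | exact: mean_const_gt0].
exists (C / 4 * mu `^ f); first by rewrite mulr_gt0 ?powR_gt0// divr_gt0.
move=> eps /andP[eps_gt0 eps_le].
pose c1 := slot_const tau w0 m eps0 lam * kap ^+ d.
pose K := (4 + 16 / Ce ^+ 2) * (m.+1%:R * (1 + c1^-1) ^+ m.+1 /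
  ((4 * top)^-1 ^+ d * c1)).
apply: (@squeeze_cvge _ _ _ _ (cst 0%E) _ (fun n => (K / (mu * n%:R) `^ eta)%:E)).
- near=> n.
  rewrite measure_ge0 /=.
  have a1 : 1 <= mu * n%:R by near: n; exact: near_ge1.
  have n_large : (m.+1 <= n)%N by near: n; exact: nbhs_infty_ge.
  have n0 : 0 < n%:R :> R by rewrite ltr0n (leq_trans _ n_large).
  have w0_lam i : w0 <= lam * (mu * n%:R) `^ alphas i.
    by move: i; near: n.
  have top_beta i h : top * (mu * n%:R) `^ betas i h <= 1 / 2.
    by move: i h; near: n.
  have side_le : top * (mu * n%:R) `^ b <= 1 / 2.
    have m0 : (0 < m)%N by [].
    exact: (top_beta (Ordinal m0) (Ordinal hd)).
  have [L L1 L2] : exists2 L : nat, L%:R * (top * (mu * n%:R) `^ b) <= 1 / 2 &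
      1 <= 4 * (L%:R * (top * (mu * n%:R) `^ b)).
    apply: exists_cell_number; rewrite side_le andbT mulr_gt0// powR_gt0//.
    exact: lt_le_trans a1.
  have b_le i h : b <= betas i h by [].
  have eta_le i : eta <= 1 + (1 - tau) * alphas i by [].
  have pr_le := clique_count_le_prob_powR (G n) hw0 mu_gt0 gamma_gt0 tau_gt1 a1
    eps01 eps_lam lam_eps w0_lam kap0 kap_le kap_top top1 b_le top_beta L1
    n_large L2 hd betasE (lexx top) gap0 exp0 eta_le.
  have -> : K / (mu * n%:R) `^ eta = (4 + 16 / Ce ^+ 2) *
      (m.+1%:R * (1 + c1^-1) ^+ m.+1 /
        ((4 * top)^-1 ^+ d * c1 * (mu * n%:R) `^ eta)).
    by rewrite /K [in RHS](invfM (_ * c1)) !mulrA.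
  apply: le_trans pr_le.
  apply: le_measure; rewrite ?inE.
  + rewrite (_ : [set t | _] = [set t |
      (clique_count (G n) eps alphas betas t)%:R <= C / 4 * mu `^ f * n%:R `^ f]).
      exact: measurable_clique_count_le.
    by apply/seteqP; split => t /=; rewrite ler_pdivrMr ?powR_gt0.
  + exact: measurable_clique_count_le.
  + move=> t /=; rewrite ler_pdivrMr ?powR_gt0// => le_eps.
    apply: (@le_trans _ _ (clique_count (G n) eps alphas betas t)%:R).
      by rewrite ler_nat; exact: clique_count_le_eps.
    by rewrite (powRM _ (ltW mu_gt0) (ltW n0)) -/Ce -/C mulrA.
- exact: cvg_cst.
- exact: cvg_inv_powR.
Unshelve. all: by end_near. Qed.

End theorem_parts.

Theorem theorem1 (R : realType) (tau w0 gamma : R) (d : nat)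
  (htau : 2 < tau < 3) (hw0 : 0 < w0) (hgamma : 1 < gamma) (hd : (1 <= d)%N)
  (disp : nat -> measure_display)
  (T : forall n, measurableType (disp n))
  (P : forall n, probability (T n) R)
  (G : forall n, girg tau w0 gamma d n (P n))
  (m : nat) (hk : (2 <= m.+1)%N) :
  (forall eps : R, 0 < eps < 1 ->
   forall (alpha : 'I_m.+1 -> R) (beta : 'I_m -> 'I_d -> R),
     (forall i, 0 <= alpha i) -> (forall i h, beta i h <= 0) ->
     windows_reachable w0 eps alpha beta ->
     is_Omega
       (fun n => 'E_(P n)[fun t : T n =>
                    (clique_count (G n) eps alpha beta t)%:R]%E)
       (fun n => n%:R `^ exponent tau gamma alpha beta))
  /\
  (m.+1%:R <> 2 / (3 - tau) ->
   let alphas : 'I_m.+1 -> R := @alpha_star R tau m in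
   let betas : 'I_m -> 'I_d -> R := @beta_star R tau d m in
   (forall (alpha : 'I_m.+1 -> R) (beta : 'I_m -> 'I_d -> R),
      is_argmax tau gamma alpha beta <-> (alpha = alphas /\ beta = betas))
   /\
   (forall eps0 : R, 0 < eps0 < 1 -> windows_reachable w0 eps0 alphas betas ->
    exists2 c : R, 0 < c &
    forall eps : R, 0 < eps <= eps0 ->
      (fun n => P n [set t | (clique_count (G n) eps alphas betas t)%:R
                     / n%:R `^ exponent tau gamma alphas betas <= c])
        @ \oo --> 0%E)).
Proof.
split=> [eps eps01 alpha beta|kneq alphas betas].
  exact: expected_clique_count_Omega.
split=> [alpha beta|]; first exact: is_argmax_star.
exact: clique_count_star_whp.
Qed.
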